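(* Let $k$ be an algebraically closed field and let $\mathcal{C}$ be a ribbon finite tensor category over $k$. Then a non-zero two-sided modified trace on $\mathrm{Proj}(\mathcal{C})$ exists if and only if $\mathcal{C}$ is unimodular.
   Context: A finite abelian category is a $k$-linear category equivalent to the category of finite-dimensional left modules over a finite-dimensional $k$-algebra. A finite tensor category is a finite abelian category $\mathcal{C}$ that is a rigid monoidal category (assumed strict) with $k$-bilinear tensor product and simple unit object $\mathbb{1}$. $\mathrm{Proj}(\mathcal{C})$ is the full subcategory of projective objects. $X^*$ is the left dual of $X$ with $\mathrm{ev}_X:X^*\otimes X\to\mathbb{1}$, $\mathrm{coev}_X:\mathbb{1}\to X\otimes X^*$; ${}^*X$ is the right dual with $\mathrm{ev}'_X:X\otimes{}^*X\to\mathbb{1}$, $\mathrm{coev}'_X:\mathbb{1}\to{}^*X\otimes X$. The duality functors are assumed strict monoidal and mutually inverse. A ribbon finite tensor category is a finite tensor category with a braiding $\sigma$ and a twist, i.e. a natural isomorphism $\theta:\mathrm{id}_{\mathcal{C}}\to\mathrm{id}_{\mathcal{C}}$ with $\theta_{X\otimes Y}=\sigma_{Y,X}\sigma_{X,Y}(\theta_X\otimes\theta_Y)$ and $(\theta_X)^*=\theta_{X^*}$. It is regarded as a pivotal category by the pivotal structure $\mathfrak{p}_X=u_X\circ\theta_X:X\to X^{**}$, where $u_X=(\mathrm{ev}_X\otimes\mathrm{id}_{X^{**}})(\sigma_{X,X^*}\otimes\mathrm{id}_{X^{**}})(\mathrm{id}_X\otimes\mathrm{coev}_{X^*})$ is the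 Drinfeld isomorphism. A two-sided modified trace on $\mathrm{Proj}(\mathcal{C})$ is a family of $k$-linear maps $\mathtt{t}_P:\mathrm{Hom}_{\mathcal{C}}(P,P)\to k$ ($P$ projective) such that $\mathtt{t}_P(gf)=\mathtt{t}_Q(fg)$ for all $f:P\to Q$, $g:Q\to P$ between projectives, and, for all projective $P$ and all $X\in\mathcal{C}$: (right) $\mathtt{t}_P\big((\mathrm{id}_P\otimes\mathrm{ev}_{X^*})(f\otimes\mathrm{id}_{X^*})(\mathrm{id}_P\otimes\mathrm{coev}_X)\big)=\mathtt{t}_{P\otimes X}\big((\mathrm{id}_P\otimes\mathfrak{p}_X^{-1})f\big)$ for all $f:P\otimes X\to P\otimes X^{**}$; (left) $\mathtt{t}_P\big((\mathrm{ev}'_{{}^*X}\otimes\mathrm{id}_P)(\mathrm{id}_{{}^*X}\otimes f)(\mathrm{coev}'_X\otimes\mathrm{id}_P)\big)=\mathtt{t}_{X\otimes P}\big((\mathfrak{p}_{{}^{**}X}\otimes\mathrm{id}_P)f\big)$ for all $f:X\otimes P\to{}^{**}X\otimes P$. For a finite-dimensional vector space $V$ and $M\in\mathcal{C}$, $V\cdot M$ is the object with $\mathrm{Hom}_{\mathcal{C}}(V\cdot M,N)\cong\mathrm{Hom}_k(V,\mathrm{Hom}_{\mathcal{C}}(M,N))$ naturally. Put $\alpha_{\mathcal{C}}=\mathbb{N}_{\mathcal{C}}(\mathbb{1})=\int^{X\in\mathcal{C}}\mathrm{Hom}_{\mathcal{C}}(\mathbb{1},X)^*\cdot X$ (the dual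 of the distinguished invertible object). $\mathcal{C}$ is unimodular if $\alpha_{\mathcal{C}}\cong\mathbb{1}$. *)

(* Defs.v *)
From HB Require Import structures.
From mathcomp Require Import all_boot all_algebra all_field.
From mathcomp Require Import boolp classical_sets.

Set Implicit Arguments.
Unset Strict Implicit.
Unset Printing Implicit Defensive.

Import GRing.Theory.

Declare Scope lincat_scope.
Delimit Scope lincat_scope with cat.
Local Open Scope ring_scope.
Local Open Scope lincat_scope.

Reserved Notation "g ∘ f" (at level 50, left associativity).
Reserved Notation "X ⊗ Y" (at level 40, left associativity).
Reserved Notation "f ⊗m g" (at level 40, left associativity).

(** * Linear categories *)

(* Morphism spaces are finite-dimensional, as they are in every finite abelian
   category. *)
Record lincat (k : fieldType) := LinCat {
  obj :> Type;
  mor : obj -> obj -> vectType k;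
  idmor : forall X, mor X X;
  mcomp : forall X Y Z, mor Y Z -> mor X Y -> mor X Z;
  mcomp1m : forall X Y (f : mor X Y), mcomp (idmor Y) f = f;
  mcompm1 : forall X Y (f : mor X Y), mcomp f (idmor X) = f;
  mcompA : forall X Y Z T (h : mor Z T) (g : mor Y Z) (f : mor X Y),
    mcomp h (mcomp g f) = mcomp (mcomp h g) f;
  mcomp_linearl : forall X Y Z (f : mor X Y) (a : k) (g g' : mor Y Z),
    mcomp (a *: g + g') f = a *: mcomp g f + mcomp g' f;
  mcomp_linearr : forall X Y Z (g : mor Y Z) (a : k) (f f' : mor X Y),
    mcomp g (a *: f + f') = a *: mcomp g f + mcomp g f'
}.

Arguments mor {k C} X Y : rename.
Arguments idmor {k C} X : rename.
Arguments mcomp {k C X Y Z} g f : rename.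
Notation "g ∘ f" := (mcomp g f) : lincat_scope.

Section Morphisms.
Variables (k : fieldType) (C : lincat k).
Implicit Types X Y Z : C.

Definition inverse_of X Y (f : mor X Y) (g : mor Y X) : Prop :=
  g ∘ f = idmor X /\ f ∘ g = idmor Y.

Definition is_iso X Y (f : mor X Y) : Prop := exists g, inverse_of f g.

Definition isomorphic X Y : Prop := exists f : mor X Y, is_iso f.

(* The inverse of f if f is an isomorphism, and 0 otherwise. *)
Definition invmor X Y (f : mor X Y) : mor Y X :=
  xget (0 : mor Y X) [set g | inverse_of f g].

Definition mono X Y (f : mor X Y) : Prop :=
  forall Z (g h : mor Z X), f ∘ g = f ∘ h -> g = h.

Definition epi X Y (f : mor X Y) : Prop :=
  forall Z (g h : mor Y Z), g ∘ f = h ∘ f -> g = h.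

(* For a monomorphism f, f = 0 means that its source is a zero object. *)
Definition simple_obj X : Prop :=
  idmor X <> 0 /\ forall Y (f : mor Y X), mono f -> f = 0 \/ is_iso f.

Definition projective (P : C) : Prop :=
  forall Y Z (e : mor Y Z) (f : mor P Z), epi e ->
  exists g : mor P Y, e ∘ g = f.

(* The identity morphism, seen as a morphism between two equal objects. *)
Definition eqm X Y (e : X = Y) : mor X Y :=
  match e in _ = Y return mor X Y with erefl => idmor X end.

End Morphisms.

(** * Equivalences of linear categories *)

Record linfunctor (k : fieldType) (C D : lincat k) := LinFunctor {
  fobj :> C -> D;
  fmap : forall X Y : C, 'Hom(mor X Y, mor (fobj X) (fobj Y));
  fmap_id : forall X : C, fmap X X (idmor X) = idmor (fobj X);
  fmap_comp : forall (X Y Z : C) (g : mor Y Z) (f : mor X Y),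
    fmap X Z (g ∘ f) = fmap Y Z g ∘ fmap X Y f
}.

Arguments fmap {k C D} F {X Y} : rename.

Record linequiv (k : fieldType) (C D : lincat k) := LinEquiv {
  eqv_fun : linfunctor C D;
  eqv_inv : linfunctor D C;
  eqv_eta : forall X : C, mor X (eqv_inv (eqv_fun X));
  eqv_eta_iso : forall X, is_iso (eqv_eta X);
  eqv_eta_nat : forall (X Y : C) (f : mor X Y),
    fmap eqv_inv (fmap eqv_fun f) ∘ eqv_eta X = eqv_eta Y ∘ f;
  eqv_eps : forall X : D, mor (eqv_fun (eqv_inv X)) X;
  eqv_eps_iso : forall X, is_iso (eqv_eps X);
  eqv_eps_nat : forall (X Y : D) (f : mor X Y),
    f ∘ eqv_eps X = eqv_eps Y ∘ fmap eqv_fun (fmap eqv_inv f)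
}.

(** * Finite-dimensional left modules over a finite-dimensional algebra *)

Section Modules.
Variables (k : fieldType) (A : falgType k).

Record fdmod := FdMod {
  carrier :> vectType k;
  mact : 'Hom(A, 'End(carrier));
  mact1 : mact 1 = \1%VF;
  mactM : forall a b : A, mact (a * b) = (mact a \o mact b)%VF
}.

Section Intertwiners.
Variables M N : fdmod.

Definition comm_defect_at (f : 'Hom(M, N)) (a : A) : 'Hom(M, N) :=
  (f \o mact M a)%VF - (mact N a \o f)%VF.

Fact comm_defect_at_is_linear f : linear (comm_defect_at f).
Proof.
move=> c a b; rewrite /comm_defect_at !linearP comp_lfunDr comp_lfunDl.
by rewrite -comp_lfunZl -comp_lfunZr scalerBr opprD addrACA.
Qed.
HB.instance Definition _ f :=
  GRing.isLinear.Build k A 'Hom(M, N) _ (comm_defect_at f)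
    (comm_defect_at_is_linear f).

Definition comm_defect (f : 'Hom(M, N)) : 'Hom(A, 'Hom(M, N)) :=
  linfun (comm_defect_at f).

Fact comm_defect_is_linear : linear comm_defect.
Proof.
move=> c f g; apply/lfunP => a.
rewrite add_lfunE scale_lfunE !lfunE /= /comm_defect_at.
rewrite comp_lfunDl comp_lfunDr.
by rewrite -comp_lfunZl -comp_lfunZr scalerBr opprD addrACA.
Qed.
HB.instance Definition _ :=
  GRing.isLinear.Build k 'Hom(M, N) 'Hom(A, 'Hom(M, N)) _ comm_defect
    comm_defect_is_linear.

Definition intertwiners : {vspace 'Hom(M, N)} := lker (linfun comm_defect).

Lemma intertwinersP (f : 'Hom(M, N)) :
  reflect (forall a, (f \o mact M a)%VF = (mact N a \o f)%VF)
          (f \in intertwiners).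
Proof.
rewrite memv_ker lfunE /=; apply: (iffP eqP) => [f0 a|fA].
  apply/eqP; rewrite -subr_eq0; apply/eqP.
  by have /lfunP/(_ a) := f0; rewrite zero_lfunE lfunE.
by apply/lfunP => a; rewrite zero_lfunE lfunE /= /comm_defect_at fA subrr.
Qed.

End Intertwiners.

Definition modhom (M N : fdmod) : vectType k := subvs_of (intertwiners M N).

Fact id_intertwiner (M : fdmod) : \1%VF \in intertwiners M M.
Proof. by apply/intertwinersP => a; rewrite comp_lfun1l comp_lfun1r. Qed.

Fact comp_intertwiner (M N P : fdmod) (g : modhom N P) (f : modhom M N) :
  (vsval g \o vsval f)%VF \in intertwiners M P.
Proof.
apply/intertwinersP => a.
rewrite -comp_lfunA (elimT (intertwinersP _) (subvsP f)).
by rewrite !comp_lfunA (elimT (intertwinersP _) (subvsP g)).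
Qed.

Definition modid (M : fdmod) : modhom M M := Subvs (id_intertwiner M).

Definition modcomp (M N P : fdmod) (g : modhom N P) (f : modhom M N) :
  modhom M P := Subvs (comp_intertwiner g f).

Fact modcomp1m M N (f : modhom M N) : modcomp (modid N) f = f.
Proof. by apply: val_inj; rewrite /= comp_lfun1l. Qed.

Fact modcompm1 M N (f : modhom M N) : modcomp f (modid M) = f.
Proof. by apply: val_inj; rewrite /= comp_lfun1r. Qed.

Fact modcompA M N P Q (h : modhom P Q) (g : modhom N P) (f : modhom M N) :
  modcomp h (modcomp g f) = modcomp (modcomp h g) f.
Proof. by apply: val_inj; rewrite /= comp_lfunA. Qed.

Fact modcomp_linearl M N P (f : modhom M N) (a : k) (g g' : modhom N P) :
  modcomp (a *: g + g') f = a *: modcomp g f + modcomp g' f.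
Proof. by apply: val_inj; rewrite /= comp_lfunDl comp_lfunZl. Qed.

Fact modcomp_linearr M N P (g : modhom N P) (a : k) (f f' : modhom M N) :
  modcomp g (a *: f + f') = a *: modcomp g f + modcomp g f'.
Proof. by apply: val_inj; rewrite /= comp_lfunDr comp_lfunZr. Qed.

Definition modcat : lincat k :=
  LinCat modcomp1m modcompm1 modcompA modcomp_linearl modcomp_linearr.

End Modules.

(* An falgType is a nonzero ring, so this leaves out the zero category, in
   which no object is simple. *)
Definition finite_abelian (k : fieldType) (C : lincat k) : Prop :=
  exists A : falgType k, inhabited (linequiv C (modcat A)).

(** * Strict monoidal categories *)

(* The associativity and unit constraints are the identities eqm of the three
   equalities of objects; the pentagon and triangle identities then hold
   automatically, because any two proofs of an equality are equal. *)
Record monoidal (k : fieldType) (C : lincat k) := Monoidal {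
  tunit : C;
  tens : C -> C -> C;
  tensm : forall X X' Y Y' : C,
    mor X X' -> mor Y Y' -> mor (tens X Y) (tens X' Y');
  tensm_id : forall X Y, tensm (idmor X) (idmor Y) = idmor (tens X Y);
  tensm_comp : forall (X X' X'' Y Y' Y'' : C)
      (f' : mor X' X'') (f : mor X X') (g' : mor Y' Y'') (g : mor Y Y'),
    tensm (f' ∘ f) (g' ∘ g) = tensm f' g' ∘ tensm f g;
  tensm_linearl : forall (X X' Y Y' : C) (g : mor Y Y') (a : k)
      (f f' : mor X X'),
    tensm (a *: f + f') g = a *: tensm f g + tensm f' g;
  tensm_linearr : forall (X X' Y Y' : C) (f : mor X X') (a : k)
      (g g' : mor Y Y'),
    tensm f (a *: g + g') = a *: tensm f g + tensm f g';
  tensA : forall X Y Z, tens X (tens Y Z) = tens (tens X Y) Z;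
  tens1o : forall X, tens tunit X = X;
  tenso1 : forall X, tens X tunit = X;
  tensmA : forall (X X' Y Y' Z Z' : C)
      (f : mor X X') (g : mor Y Y') (h : mor Z Z'),
    eqm (tensA X' Y' Z') ∘ tensm f (tensm g h)
    = tensm (tensm f g) h ∘ eqm (tensA X Y Z);
  tens1m : forall (X X' : C) (f : mor X X'),
    eqm (tens1o X') ∘ tensm (idmor tunit) f = f ∘ eqm (tens1o X);
  tensm1 : forall (X X' : C) (f : mor X X'),
    eqm (tenso1 X') ∘ tensm f (idmor tunit) = f ∘ eqm (tenso1 X)
}.

Arguments tunit {k C} m : rename.
Arguments tens {k C m} X Y : rename.
Arguments tensm {k C m X X' Y Y'} f g : rename.
Notation "X ⊗ Y" := (tens X Y) : lincat_scope.
Notation "f ⊗m g" := (tensm f g) : lincat_scope.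

Section StrictConstraints.
Variables (k : fieldType) (C : lincat k) (m : monoidal C).
Implicit Types X Y Z : C.

Definition assoc X Y Z : mor (X ⊗ (Y ⊗ Z)) ((X ⊗ Y) ⊗ Z) :=
  eqm (tensA m X Y Z).
Definition assocV X Y Z : mor ((X ⊗ Y) ⊗ Z) (X ⊗ (Y ⊗ Z)) :=
  eqm (esym (tensA m X Y Z)).
Definition lunit X : mor (tunit m ⊗ X) X := eqm (tens1o m X).
Definition lunitV X : mor X (tunit m ⊗ X) := eqm (esym (tens1o m X)).
Definition runit X : mor (X ⊗ tunit m) X := eqm (tenso1 m X).
Definition runitV X : mor X (X ⊗ tunit m) := eqm (esym (tenso1 m X)).

End StrictConstraints.

Arguments assoc {k C m} X Y Z.
Arguments assocV {k C m} X Y Z.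
Arguments lunit {k C m} X.
Arguments lunitV {k C m} X.
Arguments runit {k C m} X.
Arguments runitV {k C m} X.

(** * Rigidity *)

(* ldual X is the left dual X^*, and rdual X the right dual ^*X.

   ldual_tens, ldual_unit, ev_tens and ev_unit say that X |-> X^* is a strict
   monoidal functor to the opposite category with reversed tensor product: its
   canonical monoidal constraints, which are determined by ev, are identities.
   ldualK, rdualK, evr_ldual and coevr_ldual say that the two duality functors
   are mutually inverse: the canonical isomorphism rdual (ldual X) -> X is the
   identity.  Requiring only equalities of functors here would not be enough,
   since evr and coevr could then be rescaled by a monoidal automorphism of the
   identity functor, which changes the left partial trace.  The analogues of
   these identities for X |-> ^*X, for coev, and on morphisms are
   consequences. *)
Record rigid (k : fieldType) (C : lincat k) (m : monoidal C) := Rigid {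
  ldual : C -> C;
  ev : forall X, mor (ldual X ⊗ X) (tunit m);
  coev : forall X, mor (tunit m) (X ⊗ ldual X);
  ldual_zigzag : forall X,
    runit X ∘ (idmor X ⊗m ev X) ∘ assocV X (ldual X) X
      ∘ (coev X ⊗m idmor X) ∘ lunitV X = idmor X;
  ldual_zagzig : forall X,
    lunit (ldual X) ∘ (ev X ⊗m idmor (ldual X)) ∘ assoc (ldual X) X (ldual X)
      ∘ (idmor (ldual X) ⊗m coev X) ∘ runitV (ldual X) = idmor (ldual X);
  rdual : C -> C;
  evr : forall X, mor (X ⊗ rdual X) (tunit m);
  coevr : forall X, mor (tunit m) (rdual X ⊗ X);
  rdual_zigzag : forall X,
    lunit X ∘ (evr X ⊗m idmor X) ∘ assoc X (rdual X) X
      ∘ (idmor X ⊗m coevr X) ∘ runitV X = idmor X;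
  rdual_zagzig : forall X,
    runit (rdual X) ∘ (idmor (rdual X) ⊗m evr X) ∘ assocV (rdual X) X (rdual X)
      ∘ (coevr X ⊗m idmor (rdual X)) ∘ lunitV (rdual X) = idmor (rdual X);
  ldual_unit : ldual (tunit m) = tunit m;
  ldual_tens : forall X Y, ldual (X ⊗ Y) = ldual Y ⊗ ldual X;
  ev_unit : ev (tunit m) = eqm ldual_unit ∘ runit (ldual (tunit m));
  ev_tens : forall X Y, ev (X ⊗ Y) =
    ev Y ∘ (runit (ldual Y) ⊗m idmor Y) ∘ ((idmor (ldual Y) ⊗m ev X) ⊗m idmor Y)
      ∘ (assocV (ldual Y) (ldual X) X ⊗m idmor Y)
      ∘ assoc (ldual Y ⊗ ldual X) X Y
      ∘ (eqm (ldual_tens X Y) ⊗m idmor (X ⊗ Y));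
  ldualK : forall X, rdual (ldual X) = X;
  rdualK : forall X, ldual (rdual X) = X;
  evr_ldual : forall X,
    evr (ldual X) = ev X ∘ (idmor (ldual X) ⊗m eqm (ldualK X));
  coevr_ldual : forall X,
    coev X = (eqm (ldualK X) ⊗m idmor (ldual X)) ∘ coevr (ldual X)
}.

Section Duality.
Variables (k : fieldType) (C : lincat k) (m : monoidal C) (d : rigid m).

(* f^* *)
Definition ldualm (X Y : C) (f : mor X Y) : mor (ldual d Y) (ldual d X) :=
  lunit (ldual d X) ∘ (ev d Y ⊗m idmor (ldual d X))
    ∘ assoc (ldual d Y) Y (ldual d X)
    ∘ (idmor (ldual d Y) ⊗m (f ⊗m idmor (ldual d X)))
    ∘ (idmor (ldual d Y) ⊗m coev d X) ∘ runitV (ldual d Y).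

Definition rdual2K (X : C) : ldual d (ldual d (rdual d (rdual d X))) = X :=
  etrans (congr1 (ldual d) (rdualK d (rdual d X))) (rdualK d X).

End Duality.

(** * Braidings, twists, ribbon finite tensor categories *)

Record braiding (k : fieldType) (C : lincat k) (m : monoidal C) := Braiding {
  braid : forall X Y : C, mor (tens (m := m) X Y) (Y ⊗ X);
  braid_iso : forall X Y, is_iso (braid X Y);
  braid_nat : forall (X X' Y Y' : C) (f : mor X X') (g : mor Y Y'),
    braid X' Y' ∘ (f ⊗m g) = (g ⊗m f) ∘ braid X Y;
  braid_tensr : forall X Y Z, braid X (Y ⊗ Z) =
    assoc Y Z X ∘ (idmor Y ⊗m braid X Z) ∘ assocV Y X Z
      ∘ (braid X Y ⊗m idmor Z) ∘ assoc X Y Z;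
  braid_tensl : forall X Y Z, braid (X ⊗ Y) Z =
    assocV Z X Y ∘ (braid X Z ⊗m idmor Y) ∘ assoc X Z Y
      ∘ (idmor X ⊗m braid Y Z) ∘ assocV X Y Z
}.

Record twist (k : fieldType) (C : lincat k) (m : monoidal C) (d : rigid m)
    (s : braiding m) := Twist {
  theta : forall X : C, mor X X;
  theta_iso : forall X, is_iso (theta X);
  theta_nat : forall (X Y : C) (f : mor X Y), theta Y ∘ f = f ∘ theta X;
  theta_tens : forall X Y : C, theta (tens (m := m) X Y) =
    braid s Y X ∘ braid s X Y ∘ (theta X ⊗m theta Y);
  theta_dual : forall X : C, ldualm d (theta X) = theta (ldual d X)
}.

Record ribbon_ftc (k : fieldType) := RibbonFTC {
  rcat :> lincat k;
  rmon : monoidal rcat;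
  rrig : rigid rmon;
  rbraid : braiding rmon;
  rtwist : twist rrig rbraid;
  rfinite : finite_abelian rcat;
  runit_simple : simple_obj (tunit rmon)
}.

Section ModifiedTrace.
Variables (k : fieldType) (C : ribbon_ftc k).
Local Notation d := (rrig C).
Local Notation "X ^*" := (ldual d X) : lincat_scope.
Local Notation "''id' X" := (idmor X) (at level 10, X at level 9).
Implicit Types P Q X : C.

Definition drinfeld X : mor X (X^* )^* :=
  lunit _ ∘ (ev d X ⊗m 'id (X^* )^* )
    ∘ (braid (rbraid C) X X^* ⊗m 'id (X^* )^* )
    ∘ assoc X X^* (X^* )^* ∘ ('id X ⊗m coev d X^* ) ∘ runitV X.

Definition pivot X : mor X (X^* )^* := drinfeld X ∘ theta (rtwist C) X.

Definition right_ptrace P X (f : mor (tens (m := rmon C) P X) (P ⊗ (X^* )^* )) :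
    mor P P :=
  runit P ∘ ('id P ⊗m ev d X^* ) ∘ assocV P (X^* )^* X^*
    ∘ (f ⊗m 'id X^* ) ∘ assoc P X X^* ∘ ('id P ⊗m coev d X) ∘ runitV P.

Definition left_ptrace P X
    (f : mor (tens (m := rmon C) X P) (rdual d (rdual d X) ⊗ P)) : mor P P :=
  lunit P ∘ (evr d (rdual d X) ⊗m 'id P)
    ∘ assoc (rdual d X) (rdual d (rdual d X)) P
    ∘ ('id (rdual d X) ⊗m f) ∘ assocV (rdual d X) X P
    ∘ (coevr d X ⊗m 'id P) ∘ lunitV P.

(* Only the components of t at projective objects matter; in the last two
   conditions P ⊗ X and X ⊗ P are projective as soon as P is. *)
Record modified_trace (t : forall P, {scalar (mor P P)}) : Prop :=
    ModifiedTrace {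
  mtr_cyclic : forall P Q, projective P -> projective Q ->
    forall (f : mor P Q) (g : mor Q P), t P (g ∘ f) = t Q (f ∘ g);
  mtr_right : forall P X, projective P ->
    forall f : mor (P ⊗ X) (P ⊗ (X^* )^* ),
    t P (right_ptrace f) = t (P ⊗ X) (('id P ⊗m invmor (pivot X)) ∘ f);
  mtr_left : forall P X, projective P ->
    forall f : mor (X ⊗ P) (rdual d (rdual d X) ⊗ P),
    t P (left_ptrace f) =
    t (X ⊗ P) (((eqm (rdual2K d X) ∘ pivot (rdual d (rdual d X))) ⊗m 'id P) ∘ f)
}.

Definition nonzero_on_proj (t : forall P, {scalar (mor P P)}) : Prop :=
  exists P, projective P /\ exists f : mor P P, t P f <> 0.

End ModifiedTrace.

(** * Copowers, coends, unimodularity *)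

Section Coends.
Variables (k : fieldType) (C : lincat k).

(* The object V . M with its isomorphism
   Hom(V . M, N) = Hom_k(V, Hom(M, N)), natural in N. *)
Record copower (V : vectType k) (M : C) := Copower {
  cp_obj :> C;
  cp_to : forall N : C, 'Hom(mor cp_obj N, 'Hom(V, mor M N));
  cp_of : forall N : C, 'Hom(V, mor M N) -> mor cp_obj N;
  cp_toK : forall N, cancel (cp_to N) (@cp_of N);
  cp_ofK : forall N, cancel (@cp_of N) (cp_to N);
  cp_nat : forall (N N' : C) (h : mor N N') (g : mor cp_obj N) (v : V),
    cp_to N' (h ∘ g) v = h ∘ cp_to N g v
}.

(* The morphism V . M -> W . N induced by p : V -> W and f : M -> N. *)
Definition cp_map V W M N (T : copower V M) (U : copower W N)
    (p : 'Hom(V, W)) (f : mor M N) : mor T U :=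
  cp_of T (linfun (fun v : V => cp_to U U (idmor U) (p v) ∘ f)).

(* H is the action on objects of a functor C^op x C -> C, which is given on
   morphisms by Hl (contravariant) and Hr (covariant). *)
Section Coend.
Variables (H : C -> C -> C)
  (Hl : forall X Y Z : C, mor X Y -> mor (H Y Z) (H X Z))
  (Hr : forall Z X Y : C, mor X Y -> mor (H Z X) (H Z Y)).

Definition dinatural (T : C) (j : forall X, mor (H X X) T) : Prop :=
  forall (X Y : C) (f : mor X Y), j X ∘ Hl X f = j Y ∘ Hr Y f.

Definition is_coend (T : C) : Prop :=
  exists i : forall X, mor (H X X) T, dinatural i /\
  forall (T' : C) (j : forall X, mor (H X X) T'), dinatural j ->
  exists! g : mor T T', forall X, g ∘ i X = j X.

End Coend.

(* The transpose Hom(M, Y)^* -> Hom(M, X)^* of composition with f : X -> Y. *)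
Definition mor_transpose (M X Y : C) (f : mor X Y) :
    'Hom('Hom(mor M Y, k^o), 'Hom(mor M X, k^o)) :=
  linfun (fun p : 'Hom(mor M Y, k^o) =>
            (p \o linfun (fun g : mor M X => (f ∘ g : mor M Y)))%VF).

(* N is the coend of Hom(M, X)^* . X over X, that is, the value at M of the
   Nakayama functor.  The copowers are unique up to unique isomorphism. *)
Definition is_nakayama (M N : C) : Prop :=
  exists cp : forall X Y : C, copower 'Hom(mor M X, k^o) Y,
  is_coend (H := fun X Y => cp X Y)
    (fun X Y Z f => cp_map (cp Y Z) (cp X Z) (mor_transpose M f) (idmor Z))
    (fun Z X Y f => cp_map (cp Z X) (cp Z Y) \1%VF f) N.

End Coends.

Definition unimodular (k : fieldType) (C : ribbon_ftc k) : Prop :=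
  exists alpha : C,
    is_nakayama (tunit (rmon C)) alpha /\ isomorphic alpha (tunit (rmon C)).

(* Main.v *)
Require Import Defs.
From HB Require Import structures.
From mathcomp Require Import all_boot all_algebra all_field.
From mathcomp Require Import boolp classical_sets.

(** By dinaturality, Nakayama coends are the universal families of maps
    Hom(1, X)^* -> Hom(X, T) natural in X.  A natural family is universal as soon
    as its components at projective objects are bijective, because every object
    has a projective presentation, and for modules over an algebra A the object
    Hom_A(1, A)^* carries such a family.  So C is unimodular if and only if there
    is a perfect pairing <x, y> between Hom(1, P) and Hom(P, 1), natural in the
    projective object P.

    From a pairing one gets the trace of f : P -> P by pairing the mate
    1 -> P (x) P^* of f with the quantum evaluation P (x) P^* -> 1.  Cyclicity is
    naturality of the pairing, the right partial trace property holds because the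
    quantum evaluation of P (x) X is nested, and the left one follows from the
    right one by conjugating with the braiding of X and P.

    From a modified trace t one gets the pairing t(x y).  If y : P -> 1 is nonzero
    then it is epi, so every f : Z -> Z with Z projective is (y (x) Z) g for some
    g : Z -> P (x) Z, and t(f) is by cyclicity and the right partial trace property
    the trace of a map of the form x y; hence the pairing is nondegenerate on the
    side of y.  It is perfect since P^* is projective too and duality compares
    dimensions. *)
Set Implicit Arguments.
Unset Strict Implicit.
Unset Printing Implicit Defensive.

Import GRing.Theory.
Local Open Scope ring_scope.
Local Open Scope lincat_scope.

(** * Linear categories *)

Lemma dfun_choice (A : Type) (B : A -> Type) (R : forall a, B a -> Prop) :
  (forall a, exists b, R a b) -> exists f : forall a, B a, forall a, R a (f a).
Proof. by move=> RP; exists (fun a => sval (cid (RP a))) => a; exact: svalP. Qed.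

Lemma linfunE (k : fieldType) (V W : vectType k) (f : V -> W) :
  linear f -> linfun f =1 f.
Proof.
move=> fL; pose F : {linear V -> W} := HB.pack f (GRing.isLinear.Build k V W _ f fL).
exact: (lfunE F).
Qed.

Section LinearComposition.
Variables (k : fieldType) (C : lincat k).
Implicit Types X Y Z P Q : C.

Definition lcomp X Y Z (g : mor Y Z) : 'Hom(mor X Y, mor X Z) :=
  linfun (fun f : mor X Y => g ∘ f).

Definition rcomp X Y Z (f : mor X Y) : 'Hom(mor Y Z, mor X Z) :=
  linfun (fun g : mor Y Z => g ∘ f).

Lemma lcompE X Y Z (g : mor Y Z) (f : mor X Y) : lcomp X g f = g ∘ f.
Proof. by apply: linfunE => a f1 f2; rewrite mcomp_linearr. Qed.

Lemma rcompE X Y Z (f : mor X Y) (g : mor Y Z) : rcomp Z f g = g ∘ f.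
Proof. by apply: linfunE => a f1 f2; rewrite mcomp_linearl. Qed.

Lemma mcomp0 X Y Z (g : mor Y Z) : g ∘ (0 : mor X Y) = 0.
Proof. by rewrite -lcompE linear0. Qed.

Lemma mcomp0m X Y Z (f : mor X Y) : (0 : mor Y Z) ∘ f = 0.
Proof. by rewrite -rcompE linear0. Qed.

Lemma mcompZr X Y Z (g : mor Y Z) a (f : mor X Y) : g ∘ (a *: f) = a *: (g ∘ f).
Proof. by rewrite -!lcompE linearZ. Qed.

Lemma mcomp_sumr X Y Z n (g : mor Y Z) (f : 'I_n -> mor X Y) :
  g ∘ (\sum_i f i) = \sum_i (g ∘ f i).
Proof. by rewrite -lcompE linear_sum; apply: eq_bigr => i _ /=; rewrite lcompE. Qed.

Lemma mcomp_suml X Y Z n (g : 'I_n -> mor Y Z) (f : mor X Y) :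
  (\sum_i g i) ∘ f = \sum_i (g i ∘ f).
Proof. by rewrite -rcompE linear_sum; apply: eq_bigr => i _ /=; rewrite rcompE. Qed.

Lemma mor_transposeE M X Y (f : mor X Y) (xi : 'Hom(mor M Y, k^o)) g :
  mor_transpose M f xi g = xi (f ∘ g).
Proof.
have fE (g' : mor M X) : linfun (fun g => f ∘ g) g' = f ∘ g' by exact: lcompE.
rewrite /mor_transpose linfunE; first by rewrite comp_lfunE fE.
by move=> a p q; rewrite comp_lfunDl comp_lfunZl.
Qed.

Lemma mor_transpose_comp M X Y Z (f : mor X Y) (g : mor Y Z) xi :
  mor_transpose M (g ∘ f) xi = mor_transpose M f (mor_transpose M g xi).
Proof. by apply/lfunP => h; rewrite !mor_transposeE mcompA. Qed.

Lemma epi_rcomp_inj X Y Z (f : mor X Y) : epi f -> lker (rcomp Z f) == 0%VS.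
Proof. by move=> ef; apply/lker0P => g h; rewrite !rcompE; apply: ef. Qed.

Lemma epi_comp X Y Z (g : mor Y Z) (f : mor X Y) :
  epi g -> epi f -> epi (g ∘ f).
Proof. by move=> eg ef T h1 h2; rewrite !mcompA => /ef/eg. Qed.

Lemma iso_epi X Y (f : mor X Y) : is_iso f -> epi f.
Proof.
case=> g [_ fg] Z h1 h2 /(congr1 (fun u => u ∘ g)).
by rewrite -!mcompA fg !mcompm1.
Qed.

Lemma iso_mono X Y (f : mor X Y) : is_iso f -> mono f.
Proof.
case=> g [gf _] Z h1 h2 /(congr1 (fun u => g ∘ u)).
by rewrite !mcompA gf !mcomp1m.
Qed.

Lemma mono_comp X Y Z (g : mor Y Z) (f : mor X Y) :
  mono g -> mono f -> mono (g ∘ f).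
Proof. by move=> mg mf T h1 h2; rewrite -!mcompA => /mg/mf. Qed.

Lemma invmorP X Y (f : mor X Y) : is_iso f -> inverse_of f (invmor f).
Proof.
by rewrite /invmor; case: xgetP => [g -> //|none [g gP]]; case: (none g).
Qed.

Lemma projective_retract P Q (i : mor Q P) (r : mor P Q) :
  r ∘ i = idmor Q -> projective P -> projective Q.
Proof.
move=> ri pP Y Z e f ee; have [g eg] := pP _ _ e (f ∘ r) ee.
by exists (g ∘ i); rewrite mcompA eg -mcompA ri mcompm1.
Qed.

End LinearComposition.

(** * Nakayama coends in terms of projective objects *)

Section Nakayama.
Variables (k : fieldType) (C : lincat k).
Implicit Types M T X Y P Q : C.

(** [p] is a cokernel of [q]; the uniqueness of [g] is contained in [epi p]. *)
Definition enough_presentations := forall X : C,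
  exists (P Q : C) (p : mor P X) (q : mor Q P),
    [/\ projective P, projective Q, epi p, p ∘ q = 0 &
     forall T (h : mor P T), h ∘ q = 0 -> exists g, g ∘ p = h].

Definition enough_copowers :=
  forall (V : vectType k) (M : C), inhabited (copower V M).

(** These are the dinatural families of the Nakayama coend, read through the copower adjunction. *)
Definition nak_family M T (i : forall X, 'Hom('Hom(mor M X, k^o), mor X T)) :=
  forall X Y (f : mor X Y) xi, i X (mor_transpose M f xi) = i Y xi ∘ f.

Definition nak_universal M T (i : forall X, 'Hom('Hom(mor M X, k^o), mor X T)) :=
  forall T' (j : forall X, 'Hom('Hom(mor M X, k^o), mor X T')), nak_family j ->
  exists! g : mor T T', forall X xi, g ∘ i X xi = j X xi.

(** An epimorphism [e] from a projective onto T is itself a value of the family, so the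
    factorisation is prescribed on [e]. Lifting through [e] settles projective sources, and
    epimorphisms from projectives settle the others. *)
Lemma proj_bij_universal M T
    (i : forall X, 'Hom('Hom(mor M X, k^o), mor X T)) :
  enough_presentations -> nak_family i ->
  (forall P, projective P -> bijective (i P)) -> nak_universal i.
Proof.
move=> pres nat_i bij_i T' j nat_j.
have [P [Q [e [q [pP pQ ee eq0 univ]]]]] := pres T.
have [i' iK i'K] := bij_i P pP.
pose xi0 := i' e.
(* Injectivity at Q turns [e ∘ q = 0] into the vanishing of this functional, so that [j P xi0]
   descends along the cokernel [e]. *)
have q0 : mor_transpose M q xi0 = 0.
  apply: (bij_inj (bij_i Q pQ)).
  by rewrite nat_i i'K eq0 linear0.
have [g gE] : exists g, g ∘ e = j P xi0.
  by apply: univ; rewrite -nat_j q0 linear0.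
exists g; split; last first.
  by move=> g' /(_ P xi0); rewrite i'K -gE => /ee.
have gP P' : projective P' -> forall xi, g ∘ i P' xi = j P' xi.
  move=> pP' xi; have [h hE] := pP' _ _ e (i P' xi) ee.
  have xiE : xi = mor_transpose M h xi0.
    by apply: (bij_inj (bij_i P' pP')); rewrite nat_i i'K.
  by rewrite xiE nat_i nat_j i'K mcompA gE.
move=> X xi; have [P' [_ [p' [_ [pP' _ ep' _ _]]]]] := pres X.
by apply: ep'; rewrite -mcompA -nat_i gP // nat_j.
Qed.

(** At X the family is the inverse of [kap] at a projective over X, descended to X along the
    presentation; it is natural because morphisms lift to these projectives. *)
Lemma extend_nak_family M T
    (kap : forall P, 'Hom(mor P T, 'Hom(mor M P, k^o))) :
  enough_presentations ->
  (forall P Q (f : mor P Q) y, projective P -> projective Q ->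
     kap P (y ∘ f) = mor_transpose M f (kap Q y)) ->
  (forall P, projective P -> bijective (kap P)) ->
  exists i : forall X, 'Hom('Hom(mor M X, k^o), mor X T),
    nak_family i /\ forall P, projective P -> bijective (i P).
Proof.
move=> pres nat_kap bij_kap.
have kapK P : projective P -> lker (kap P) == 0%VS.
  by move=> pP; apply/lker0P/bij_inj/bij_kap.
have kapVK P (pP : projective P) : cancel (kap P)^-1%VF (kap P).
  move=> xi; have [g gK Kg] := bij_kap P pP.
  by rewrite -[xi]Kg (lker0_lfunK (kapK P pP)).
have nat_inv P Q (f : mor P Q) xi : projective P -> projective Q ->
    (kap P)^-1%VF (mor_transpose M f xi) = (kap Q)^-1%VF xi ∘ f.
  move=> pP pQ; apply: (bij_inj (bij_kap P pP)).
  by rewrite kapVK // nat_kap // kapVK.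
have [Pr prP] := choice pres.
have [Qr {}prP] := choice prP.
have [pr prE] := dfun_choice prP.
(* Precomposition with the epimorphism [pr X] is injective, so its [^-1] recovers a factorisation
   through [pr X] linearly. *)
pose i X := ((rcomp T (pr X))^-1 \o (kap (Pr X))^-1 \o mor_transpose M (pr X))%VF.
have iE X xi : i X xi ∘ pr X = (kap (Pr X))^-1%VF (mor_transpose M (pr X) xi).
  have [q [pP pQ ep pq univ]] := prE X.
  have [g gE] : exists g,
      g ∘ pr X = (kap (Pr X))^-1%VF (mor_transpose M (pr X) xi).
    apply: univ; rewrite -nat_inv // -mor_transpose_comp pq.
    have -> : mor_transpose M (0 : mor (Qr X) X) xi = 0.
      by apply/lfunP => h; rewrite mor_transposeE mcomp0m linear0 zero_lfunE.
    by rewrite linear0.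
  rewrite /i !comp_lfunE -gE -(rcompE _ g).
  by rewrite (lker0_lfunK (epi_rcomp_inj _ ep)) rcompE.
exists i; split.
- move=> X Y f xi; have [q [pP _ ep _ _]] := prE X.
  have [q' [pP' _ ep' _ _]] := prE Y.
  have [h hE] := pP _ _ (pr Y) (f ∘ pr X) ep'.
  apply: ep; rewrite iE -mor_transpose_comp -hE mor_transpose_comp nat_inv //.
  by rewrite -iE -!mcompA hE.
- move=> P pP; suff -> : i P = (kap P)^-1%VF.
    have [g gK Kg] := bij_kap P pP.
    exists (kap P); first exact: kapVK.
    exact: (lker0_lfunK (kapK P pP)).
  apply/lfunP => xi; have [q [pP' _ ep _ _]] := prE P.
  by apply: ep; rewrite iE nat_inv.
Qed.

Section CopowerMaps.
Variables (V W : vectType k).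
Variables (M N : C) (T : copower V M) (U : copower W N).

Lemma cp_mapE (p : 'Hom(V, W)) (f : mor M N) Z (h : mor U Z) v :
  cp_to T Z (h ∘ cp_map T U p f) v = cp_to U Z h (p v) ∘ f.
Proof.
rewrite cp_nat /cp_map cp_ofK linfunE; last first.
  move=> a u v'; rewrite (linearP p) (linearP (cp_to U U (idmor U))) /=.
  by rewrite mcomp_linearl.
by rewrite mcompA -cp_nat mcompm1.
Qed.

End CopowerMaps.

Section CoendOfFamily.
Variables (M T : C) (cp : forall X Y : C, copower 'Hom(mor M X, k^o) Y).

(** Both sides of dinaturality at f : X -> Y start at the copower of Hom(M, Y)^* with X, and their
    transposes are the two sides of naturality. *)
Lemma dinatural_nak_family (T' : C) (j : forall X, mor (cp X X) T') :
  dinatural (H := fun X Y => cp X Y)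
    (fun X Y Z f => cp_map (cp Y Z) (cp X Z) (mor_transpose M f) (idmor Z))
    (fun Z X Y f => cp_map (cp Z X) (cp Z Y) \1%VF f) j <->
  nak_family (fun X => cp_to (cp X X) T' (j X)).
Proof.
split=> nat_j X Y f.
- move=> xi; have := nat_j X Y f.
  move=> /(congr1 (fun u => cp_to (cp Y X) T' u xi)).
  by rewrite !cp_mapE mcompm1 id_lfunE.
- apply: (can_inj (cp_toK (c := cp Y X) (N := T'))).
  by apply/lfunP => xi; rewrite !cp_mapE mcompm1 id_lfunE nat_j.
Qed.

End CoendOfFamily.

(** Transposing cocones with [cp_to] and [cp_of] removes the copowers; [enough_copowers] supplies
    them again for the converse. *)
Lemma is_nakayamaP M T : enough_copowers ->
  is_nakayama M T <->
  exists i : forall X, 'Hom('Hom(mor M X, k^o), mor X T),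
    nak_family i /\ nak_universal i.
Proof.
move=> ecp; split.
- case=> cp [i [/dinatural_nak_family nat_i univ]].
  exists (fun X => cp_to (cp X X) T (i X)); split=> // T' j nat_j.
  pose j' X := cp_of (cp X X) (j X).
  have j'E : (fun X => cp_to (cp X X) T' (j' X)) = j.
    by apply: functional_extensionality_dep => X; rewrite /j' cp_ofK.
  have /dinatural_nak_family/univ : nak_family (fun X => cp_to (cp X X) T' (j' X)).
    by rewrite j'E.
  case=> g [gE gU]; exists g; split.
    by move=> X xi; rewrite -cp_nat gE /j' cp_ofK.
  move=> g' g'E; apply: gU => X.
  apply: (can_inj (cp_toK (c := cp X X) (N := T'))).
  by apply/lfunP => xi; rewrite cp_nat g'E /j' cp_ofK.
- case=> i [nat_i univ].
  pose cp X Y : copower 'Hom(mor M X, k^o) Y := inhabited_witness (ecp _ Y).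
  exists cp, (fun X => cp_of (cp X X) (i X)); split.
    apply/dinatural_nak_family => X Y f xi.
    by rewrite !cp_ofK nat_i.
  move=> T' j /dinatural_nak_family/univ[g [gE gU]]; exists g; split.
    move=> X; apply: (can_inj (cp_toK (c := cp X X) (N := T'))).
    by apply/lfunP => xi; rewrite cp_nat cp_ofK gE.
  by move=> g' g'E; apply: gU => X xi; rewrite -g'E cp_nat cp_ofK.
Qed.

End Nakayama.

Lemma projective_copower (k : fieldType) (C : lincat k) (V : vectType k) (M : C)
  (T : copower V M) : projective M -> projective (T : C).
Proof.
move=> pM Y Z e f ee.
(* Since M is projective, postcomposition with [e] is surjective on maps from M, and its [^-1] is a
   linear section. *)
exists (cp_of T ((lcomp M e)^-1 \o cp_to T Z f)%VF).
apply: (can_inj (cp_toK (c := T) (N := Z))); apply/lfunP => v.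
rewrite cp_nat cp_ofK comp_lfunE -lcompE limg_lfunVK //.
have [g <-] := pM _ _ e (cp_to T Z f v) ee.
by rewrite -lcompE memv_img ?memvf.
Qed.

(** * Modules over a finite-dimensional algebra *)

Section ModuleBuild.
Variables (k : fieldType) (A : falgType k) (V : vectType k) (act : A -> V -> V).
Hypotheses (act_linr : forall a, linear (act a))
  (act_linl : forall v, linear (act^~ v))
  (act1 : forall v, act 1 v = v)
  (actM : forall a b v, act (a * b) v = act a (act b v)).

Definition act_lfun : 'Hom(A, 'End(V)) := linfun (fun a => linfun (act a)).

Lemma act_lfunE a v : act_lfun a v = act a v.
Proof.
rewrite linfunE; first exact: linfunE.
move=> c b b'; apply/lfunP => w.
by rewrite add_lfunE scale_lfunE !linfunE //; exact: act_linl.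
Qed.

Fact act_lfun1 : act_lfun 1 = \1%VF.
Proof. by apply/lfunP => v; rewrite act_lfunE id_lfunE. Qed.

Fact act_lfunM a b : act_lfun (a * b) = (act_lfun a \o act_lfun b)%VF.
Proof. by apply/lfunP => v; rewrite comp_lfunE !act_lfunE. Qed.

Definition mkmod : fdmod A := FdMod act_lfun1 act_lfunM.

End ModuleBuild.

Section ModuleMorphisms.
Variables (k : fieldType) (A : falgType k).
Implicit Types M N P : fdmod A.

Definition happ M N (f : mor (M : modcat A) N) : 'Hom(M, N) := vsval f.
Arguments happ : simpl never.

Lemma happ_mact M N (f : mor (M : modcat A) N) a x :
  happ f (mact M a x) = mact N a (happ f x).
Proof.
have /lfunP/(_ x) := elimT (intertwinersP (happ f)) (subvsP f) a.
by rewrite !comp_lfunE.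
Qed.

Lemma happ_inj M N (f g : mor (M : modcat A) N) : happ f =1 happ g -> f = g.
Proof. by move=> fg; apply: val_inj; apply/lfunP. Qed.

Lemma happ_comp M N P (g : mor (N : modcat A) P) (f : mor (M : modcat A) N) x :
  happ (g ∘ f) x = happ g (happ f x).
Proof. by rewrite /happ /= comp_lfunE. Qed.

Lemma happ_id M x : happ (idmor (M : modcat A)) x = x.
Proof. by rewrite /happ /= id_lfunE. Qed.

Lemma happ_linear M N a (f g : mor (M : modcat A) N) x :
  happ (a *: f + g) x = a *: happ f x + happ g x.
Proof. by rewrite /happ linearP add_lfunE scale_lfunE. Qed.

Lemma happ0 M N x : happ (0 : mor (M : modcat A) N) x = 0.
Proof. by rewrite /happ linear0 zero_lfunE. Qed.

Lemma happ_sum M N n (f : 'I_n -> mor (M : modcat A) N) x :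
  happ (\sum_i f i) x = \sum_i happ (f i) x.
Proof. by rewrite /happ linear_sum sum_lfunE. Qed.

Section HomBuild.
Variables (M N : fdmod A) (f : M -> N).
Hypotheses (f_lin : linear f) (f_mact : forall a x, f (mact M a x) = mact N a (f x)).

Fact mkhom_subproof : linfun f \in intertwiners M N.
Proof.
by apply/intertwinersP => a; apply/lfunP => x; rewrite !comp_lfunE !linfunE.
Qed.

Definition mkhom : mor (M : modcat A) N := Subvs mkhom_subproof.

Lemma mkhomE x : happ mkhom x = f x.
Proof. exact: linfunE. Qed.

End HomBuild.

Lemma mact_linl M x : linear (fun a : A => mact M a x).
Proof. by move=> c a b; rewrite linearP add_lfunE scale_lfunE. Qed.

Fact regmod_linr (a : A) : linear (fun b : A => a * b).
Proof. by move=> c x y; rewrite mulrDr scalerAr. Qed.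

Fact regmod_linl (b : A) : linear (fun a : A => a * b).
Proof. by move=> c x y; rewrite mulrDl scalerAl. Qed.

Definition regmod : fdmod A :=
  mkmod regmod_linr regmod_linl (@mul1r A) (fun a b c => esym (mulrA a b c)).

Lemma regmodE (a b : A) : mact regmod a b = a * b.
Proof. exact: (act_lfunE regmod_linr regmod_linl). Qed.

Fact orbmap_mact M (x : M) (a b : A) :
  mact M (mact regmod a b) x = mact M a (mact M b x).
Proof. by rewrite regmodE mactM comp_lfunE. Qed.

Definition orbmap M (x : M) : mor (regmod : modcat A) M :=
  @mkhom regmod M (fun a : A => mact M a x) (mact_linl x) (orbmap_mact x).

Lemma orbmapE M (x : M) a : happ (orbmap x) a = mact M a x.
Proof. exact: mkhomE. Qed.

Lemma happ_orbmap M (f : mor (regmod : modcat A) M) : f = orbmap (happ f 1).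
Proof.
by apply: happ_inj => a; rewrite orbmapE -happ_mact regmodE mulr1.
Qed.

Lemma comp_orbmap M N (f : mor (M : modcat A) N) x :
  f ∘ orbmap x = orbmap (happ f x).
Proof. by apply: happ_inj => a; rewrite happ_comp !orbmapE happ_mact. Qed.

Section Coinduced.
Variable V : vectType k.

Let act (a : A) (F : 'Hom(A, V)) : 'Hom(A, V) := linfun (fun b => F (b * a)).

Let actE a F b : act a F b = F (b * a).
Proof. by apply: linfunE => c x y; rewrite mulrDl -scalerAl linearP. Qed.

Fact coind_linr a : linear (act a).
Proof.
move=> c F G; apply/lfunP => b.
by rewrite add_lfunE scale_lfunE !actE add_lfunE scale_lfunE.
Qed.

Fact coind_linl F : linear (act^~ F).
Proof.
move=> c a b; apply/lfunP => x.
by rewrite add_lfunE scale_lfunE !actE mulrDr -scalerAr linearP.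
Qed.

Fact coind1 F : act 1 F = F.
Proof. by apply/lfunP => b; rewrite actE mulr1. Qed.

Fact coindM a b F : act (a * b) F = act a (act b F).
Proof. by apply/lfunP => x; rewrite !actE mulrA. Qed.

Definition coindmod : fdmod A := mkmod coind_linr coind_linl coind1 coindM.

Lemma coindE a (F : coindmod) (b : A) :
  (mact coindmod a F : 'Hom(A, V)) b = (F : 'Hom(A, V)) (b * a).
Proof. by rewrite (act_lfunE coind_linr coind_linl) actE. Qed.

End Coinduced.

Section CoinducedMap.
Variables (M : fdmod A) (V : vectType k) (phi : 'Hom(M, V)).

Let F (x : M) : 'Hom(A, V) := linfun (fun a => phi (mact M a x)).

Let FE x a : F x a = phi (mact M a x).
Proof. by apply: linfunE => c b b'; rewrite mact_linl linearP. Qed.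

Fact coind_map_lin : linear (F : M -> coindmod V).
Proof.
move=> c x y; apply/lfunP => a.
by rewrite add_lfunE scale_lfunE !FE !linearP.
Qed.

Fact coind_map_mact a x : F (mact M a x) = mact (coindmod V) a (F x).
Proof. by apply/lfunP => b; rewrite coindE !FE mactM comp_lfunE. Qed.

(** The adjunct of [phi]: coinduction is right adjoint to forgetting the action. *)
Definition coind_map : mor (M : modcat A) (coindmod V) :=
  mkhom coind_map_lin coind_map_mact.

Lemma coind_mapE x a : (happ coind_map x : 'Hom(A, V)) a = phi (mact M a x).
Proof. by rewrite mkhomE FE. Qed.

End CoinducedMap.

Lemma surj_epi M N (f : mor (M : modcat A) N) :
  (forall y, exists x, happ f x = y) -> epi f.
Proof.
move=> fS P g h gh; apply: happ_inj => y; have [x <-] := fS y.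
by rewrite -!happ_comp gh.
Qed.

(* A submodule I is the kernel of the map to the coinduced module attached to a
   linear projection with kernel I. *)
Lemma epi_surj M N (f : mor (M : modcat A) N) :
  epi f -> forall y, exists x, happ f x = y.
Proof.
move=> fE y; pose phi := (\1 - projv (limg (happ f)))%VF.
have phi0 x : phi (happ f x) = 0.
  by rewrite add_lfunE opp_lfunE id_lfunE projv_id ?subrr // memv_img ?memvf.
have c0 : coind_map phi = 0.
  apply: fE; rewrite mcomp0m; apply: happ_inj => x; rewrite happ0 happ_comp.
  by apply/lfunP => a; rewrite coind_mapE zero_lfunE -happ_mact phi0.
have : y \in limg (happ f).
  have /lfunP/(_ 1) := congr1 (fun g => happ g y) c0.
  rewrite coind_mapE happ0 zero_lfunE mact1 id_lfunE add_lfunE opp_lfunE.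
  by rewrite id_lfunE => /subr0_eq ->; apply: memv_proj.
by case/memv_imgP => x _ ->; exists x.
Qed.

Lemma inj_mono M N (f : mor (M : modcat A) N) : injective (happ f) -> mono f.
Proof.
by move=> fI P g h gh; apply: happ_inj => x; apply: fI; rewrite -!happ_comp gh.
Qed.

Section Image.
Variables (M N : fdmod A) (f : mor (M : modcat A) N).

Let U := limg (happ f).
Let act (a : A) (u : subvs_of U) : subvs_of U := vsproj U (mact N a (vsval u)).

Let actE a u : vsval (act a u) = mact N a (vsval u).
Proof.
rewrite /act vsprojK //; case/memv_imgP: (subvsP u) => x _ ->.
by rewrite -happ_mact memv_img ?memvf.
Qed.

Fact image_linr a : linear (act a).
Proof. by move=> c u v; apply: val_inj; rewrite /= !actE /= linearP. Qed.

Fact image_linl u : linear (act^~ u).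
Proof.
move=> c a b; apply: val_inj.
by rewrite linearP /= !actE linearP add_lfunE scale_lfunE.
Qed.

Fact image1 u : act 1 u = u.
Proof. by apply: val_inj; rewrite /= actE mact1 id_lfunE. Qed.

Fact imageM a b u : act (a * b) u = act a (act b u).
Proof. by apply: val_inj; rewrite /= !actE mactM comp_lfunE. Qed.

Definition immod : fdmod A := mkmod image_linr image_linl image1 imageM.

Let immodE a (u : immod) :
  vsval (mact immod a u : subvs_of U) = mact N a (vsval (u : subvs_of U)).
Proof. by rewrite (act_lfunE image_linr image_linl) actE. Qed.

Fact im_incl_lin : linear (fun u : immod => vsval (u : subvs_of U)).
Proof. by move=> c u v; rewrite linearP. Qed.

Definition im_incl : mor (immod : modcat A) N := mkhom im_incl_lin immodE.

Let im_inclE (u : immod) : happ im_incl u = vsval (u : subvs_of U).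
Proof. exact: mkhomE. Qed.

Let p (x : M) : immod := vsproj U (happ f x).
Let pE x : vsval (p x : subvs_of U) = happ f x.
Proof. by rewrite vsprojK // memv_img ?memvf. Qed.

Fact im_proj_lin : linear p.
Proof. by move=> c u v; apply: val_inj; rewrite linearP /= !pE linearP. Qed.

Fact im_proj_mact a x : p (mact M a x) = mact immod a (p x).
Proof. by apply: val_inj; rewrite /= immodE !pE happ_mact. Qed.

Definition im_proj : mor (M : modcat A) immod := mkhom im_proj_lin im_proj_mact.

Let im_projE x : happ im_proj x = p x.
Proof. exact: mkhomE. Qed.

Lemma im_factor :
  [/\ epi im_proj, mono im_incl & im_incl ∘ im_proj = f].
Proof.
split.
- apply: surj_epi => u; case/memv_imgP: (subvsP (u : subvs_of U)) => x _ ux.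
  by exists x; apply: val_inj; rewrite im_projE; exact: etrans (pE x) (esym ux).
- by apply: inj_mono => u v; rewrite !im_inclE => /val_inj.
- by apply: happ_inj => x; rewrite happ_comp im_inclE im_projE pE.
Qed.

End Image.

Section Power.
Variables (n : nat) (M : fdmod A).

Let act (a : A) (w : {ffun 'I_n -> M}) : {ffun 'I_n -> M} :=
  [ffun i => mact M a (w i)].

Fact pow_linr a : linear (act a).
Proof. by move=> c u v; apply/ffunP => i; rewrite !ffunE linearP. Qed.

Fact pow_linl u : linear (act^~ u).
Proof.
by move=> c a b; apply/ffunP => i; rewrite !ffunE linearP add_lfunE scale_lfunE.
Qed.

Fact pow1 u : act 1 u = u.
Proof. by apply/ffunP => i; rewrite ffunE mact1 id_lfunE. Qed.

Fact powM a b u : act (a * b) u = act a (act b u).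
Proof. by apply/ffunP => i; rewrite !ffunE mactM comp_lfunE. Qed.

Definition powmod : fdmod A := mkmod pow_linr pow_linl pow1 powM.

Let powmodE a (w : powmod) i :
  (mact powmod a w : {ffun 'I_n -> M}) i = mact M a ((w : {ffun 'I_n -> M}) i).
Proof. by rewrite (act_lfunE pow_linr pow_linl) ffunE. Qed.

Fact pow_proj_lin (i : 'I_n) : linear (fun w : powmod => (w : {ffun 'I_n -> M}) i).
Proof. by move=> c u v; rewrite !ffunE. Qed.

Definition pow_proj i : mor (powmod : modcat A) M :=
  mkhom (pow_proj_lin i) (fun a w => powmodE a w i).

Lemma pow_projE i (w : powmod) : happ (pow_proj i) w = (w : {ffun 'I_n -> M}) i.
Proof. exact: mkhomE. Qed.

Definition pow_tuple (c : 'I_n -> k) (x : M) : powmod := [ffun i => c i *: x].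

Fact pow_diag_lin c : linear (pow_tuple c).
Proof.
move=> d x y; apply/ffunP => i.
by rewrite !ffunE scalerDr !scalerA mulrC.
Qed.

Fact pow_diag_mact c a x : pow_tuple c (mact M a x) = mact powmod a (pow_tuple c x).
Proof. by apply/ffunP => i; rewrite powmodE !ffunE linearZ. Qed.

Definition pow_diag c : mor (M : modcat A) powmod :=
  mkhom (pow_diag_lin c) (pow_diag_mact c).

Lemma pow_diagE c x : happ (pow_diag c) x = pow_tuple c x.
Proof. exact: mkhomE. Qed.

Lemma pow_proj_diag c i : pow_proj i ∘ pow_diag c = c i *: idmor (M : modcat A).
Proof.
apply: happ_inj => x; rewrite happ_comp pow_projE pow_diagE ffunE.
by rewrite /happ linearZ scale_lfunE /= id_lfunE.
Qed.

Lemma pow_id : \sum_i (pow_diag (fun j => (i == j)%:R) ∘ pow_proj i)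
  = idmor (powmod : modcat A).
Proof.
apply: happ_inj => w; rewrite happ_id happ_sum; apply/ffunP => j.
rewrite sum_ffunE (bigD1 j) // big1 => [|i /negPf ij].
  by rewrite happ_comp pow_diagE pow_projE ffunE eqxx scale1r; exact: addr0.
by rewrite happ_comp pow_diagE ffunE ij scale0r.
Qed.

End Power.

Section CopowerModule.
Variables (V : vectType k) (M : fdmod A).

Let n := \dim {:V}.
Let c (v : V) (i : 'I_n) : k := coord (vbasis {:V}) i v.
Let b (i : 'I_n) : V := (vbasis {:V})`_i.
(** The copower is realised as the power M^n with n = dim V, and [iota] is its universal family of
    maps. *)
Let iota v : mor (M : modcat A) (powmod n M) := pow_diag M (c v).

Let iotaP : linear iota.
Proof.
move=> a u v; apply: happ_inj => x; rewrite happ_linear !pow_diagE.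
by apply/ffunP => i; rewrite !ffunE /c linearP /= scalerDl scalerA.
Qed.

Let to N : 'Hom(mor (powmod n M : modcat A) N, 'Hom(V, mor (M : modcat A) N)) :=
  linfun (fun g => linfun (fun v => g ∘ iota v)).

Let toE N (g : mor (powmod n M : modcat A) N) v : to N g v = g ∘ iota v.
Proof.
have E (h : mor (powmod n M : modcat A) N) :
    linfun (fun v => h ∘ iota v) =1 fun v => h ∘ iota v.
  by apply: linfunE => a u v'; rewrite iotaP mcomp_linearr.
rewrite /to linfunE; first exact: E.
move=> a g1 g2; apply/lfunP => w; rewrite add_lfunE scale_lfunE !E.
exact: mcomp_linearl.
Qed.

Let tof N (F : 'Hom(V, mor (M : modcat A) N)) : mor (powmod n M : modcat A) N :=
  \sum_i (F (b i) ∘ pow_proj M i).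

Let b_free : free (vbasis {:V}).
Proof. exact: basis_free (vbasisP _). Qed.

Let toK N : cancel (to N) (@tof N).
Proof.
move=> g; rewrite /tof -[RHS]mcompm1 -pow_id mcomp_sumr; apply: eq_bigr => i _.
rewrite toE -mcompA; congr (_ ∘ _); congr (_ ∘ _).
apply: happ_inj => x; rewrite !pow_diagE; apply/ffunP => j; rewrite !ffunE.
by rewrite /c /b coord_free // eq_sym.
Qed.

Let ofK N : cancel (@tof N) (to N).
Proof.
move=> F; apply/lfunP => v; rewrite toE /tof mcomp_suml.
rewrite [in RHS](coord_vbasis (memvf v)) linear_sum; apply: eq_bigr => i _.
rewrite -mcompA pow_proj_diag mcompZr mcompm1; exact: (esym (linearZZ F _ _)).
Qed.

Definition copower_mod : copower (C := modcat A) V M :=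
  @Copower k (modcat A) V M (powmod n M) to (@tof) toK ofK
    (fun N N' h g v => etrans (toE (h ∘ g) v)
       (etrans (esym (mcompA h g (iota v))) (congr1 (mcomp h) (esym (toE g v))))).

End CopowerModule.

End ModuleMorphisms.

(** * Presentations, copowers and the Nakayama functor of a module category *)

Section ModuleCategory.
Variables (k : fieldType) (A : falgType k).
Implicit Types M N P X : fdmod A.

Lemma projective_regmod : projective (regmod A : modcat A).
Proof.
move=> Y Z e f /epi_surj eS; have [y ey] := eS (happ f 1).
by exists (orbmap y); rewrite comp_orbmap ey -happ_orbmap.
Qed.

Lemma orbmap_linear M : linear (@orbmap k A M).
Proof.
move=> c x y; apply: happ_inj => a.
by rewrite happ_linear !orbmapE linearP.
Qed.

Section FreeCover.
Variables (V : vectType k) (X : fdmod A) (phi : 'Hom(V, X)).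

Let T := copower_mod V (regmod A).

(** The A-linear extension of [phi] to the free module on V, which is the copower of V with A. *)
Definition free_map : mor (T : modcat A) X :=
  cp_of T (linfun (@orbmap k A X) \o phi)%VF.

Lemma free_mapE v : cp_to T X free_map v = orbmap (phi v).
Proof. by rewrite cp_ofK comp_lfunE linfunE //; exact: orbmap_linear. Qed.

Lemma free_map_iota v :
  free_map ∘ cp_to T T (idmor (T : modcat A)) v = orbmap (phi v).
Proof. by rewrite -cp_nat mcompm1 free_mapE. Qed.

Lemma free_map_attains v : exists w, happ free_map w = phi v.
Proof.
exists (happ (cp_to T T (idmor (T : modcat A)) v) 1).
by rewrite -happ_comp free_map_iota orbmapE mact1 id_lfunE.
Qed.

Lemma comp_free_map_eq0 N (h : mor (X : modcat A) N) :
  h ∘ free_map = 0 <-> forall v, happ h (phi v) = 0.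
Proof.
split=> [h0 v|h0].
  by have [w <-] := free_map_attains v; rewrite -happ_comp h0 happ0.
apply: (can_inj (cp_toK (c := T) (N := N))); apply/lfunP => v.
rewrite cp_nat free_mapE comp_orbmap h0 linear0 zero_lfunE.
by apply: happ_inj => a; rewrite orbmapE linear0 happ0.
Qed.

End FreeCover.

Lemma free_cover_surj X x :
  exists w, happ (free_map (\1%VF : 'Hom(X, X))) w = x.
Proof.
have [w wE] := free_map_attains (\1%VF : 'Hom(X, X)) x.
by exists w; rewrite wE id_lfunE.
Qed.

(** X is covered by the free module on its underlying space, and the kernel of this cover by the
    free module on the kernel. *)
Lemma modcat_presentations : enough_presentations (modcat A).
Proof.
move=> X; pose p := free_map (\1%VF : 'Hom(X, X)).
have pS : forall x, exists w, happ p w = x := @free_cover_surj X.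
pose K := lker (happ p).
pose q := free_map (linfun (vsval : subvs_of K -> _)).
have qE (v : subvs_of K) : linfun (vsval : subvs_of K -> _) v = vsval v.
  by rewrite lfunE.
exists (cp_obj (copower_mod X (regmod A))).
exists (cp_obj (copower_mod (subvs_of K) (regmod A))), p, q.
split.
- apply: projective_copower; exact: projective_regmod.
- apply: projective_copower; exact: projective_regmod.
- exact: (surj_epi pS).
- apply/comp_free_map_eq0 => v; rewrite qE; apply/eqP.
  by rewrite -memv_ker; exact: subvsP.
move=> T h /comp_free_map_eq0 h0.
have hK y : y \in K -> happ h y = 0.
  by move=> yK; rewrite -[y](vsprojK yK) -qE h0.
(* As [h] vanishes on the kernel of [p], its value at a preimage does not depend on the preimage;
   [^-1] chooses preimages linearly. *)
pose g (x : X) : T := happ h ((happ p)^-1%VF x).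
have gE y : g (happ p y) = happ h y.
  apply/subr0_eq; rewrite -linearB; apply: hK.
  rewrite memv_ker linearB /= limg_lfunVK ?memv_img ?memvf //.
  by apply/eqP; apply: subrr.
have g_lin : linear g by move=> c x y; rewrite /g !linearP.
have g_mact a x : g (mact X a x) = mact T a (g x).
  by have [y <-] := pS x; rewrite -happ_mact !gE happ_mact.
exists (@mkhom _ _ X T g g_lin g_mact).
by apply: happ_inj => y; rewrite happ_comp mkhomE gE.
Qed.

Lemma modcat_copowers : enough_copowers (modcat A).
Proof. by move=> V M; constructor; exact: copower_mod. Qed.

Lemma modcat_images (M N : modcat A) (f : mor M N) :
  exists (I : modcat A) (p : mor M I) (i : mor I N),
    [/\ epi p, mono i & i ∘ p = f].
Proof. by exists (immod f), (im_proj f), (im_incl f); exact: im_factor. Qed.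

(* A projective module is a retract of a free module, hence has a dual basis. *)
Lemma dual_basis (P : modcat A) : projective P ->
  exists n (b : 'I_n -> mor (regmod A : modcat A) P)
    (c : 'I_n -> mor P (regmod A : modcat A)), \sum_i (b i ∘ c i) = idmor P.
Proof.
move=> pP; pose n := \dim {:(P : fdmod A)}.
pose p : mor (powmod n (regmod A) : modcat A) P := free_map (\1%VF : 'Hom(P, P)).
have ep : epi p by apply: surj_epi; exact: free_cover_surj.
have [s ps] := pP _ _ p (idmor P) ep.
exists n, (fun i => p ∘ pow_diag (regmod A) (fun j => (i == j)%:R)).
exists (fun i => pow_proj (regmod A) i ∘ s).
rewrite -ps -[s in RHS]mcomp1m -(pow_id n (regmod A)) mcomp_suml mcomp_sumr.
by apply: eq_bigr => i _; rewrite -!mcompA.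
Qed.

Section NakayamaModule.
Variable M : fdmod A.

Let H : vectType k := mor (M : modcat A) (regmod A).
Let D : vectType k := 'Hom(H, k^o).
Let act (a : A) (xi : D) : D :=
  mor_transpose (C := modcat A) M (orbmap (a : regmod A)) xi.

Fact nakmod_linr a : linear (act a).
Proof.
move=> c F G; apply/lfunP => b.
by rewrite add_lfunE scale_lfunE !mor_transposeE add_lfunE scale_lfunE.
Qed.

Fact nakmod_linl F : linear (act^~ F).
Proof.
move=> c a b; apply/lfunP => x.
by rewrite add_lfunE scale_lfunE !mor_transposeE orbmap_linear mcomp_linearl linearP.
Qed.

Fact nakmod1 F : act 1 F = F.
Proof.
apply/lfunP => b; rewrite mor_transposeE.
suff -> : orbmap (1 : regmod A) = idmor (regmod A : modcat A) by rewrite mcomp1m.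
by apply: happ_inj => x; rewrite orbmapE regmodE mulr1 happ_id.
Qed.

Fact nakmodM a b F : act (a * b) F = act a (act b F).
Proof.
rewrite /act -mor_transpose_comp comp_orbmap orbmapE.
by rewrite -[a * b]regmodE.
Qed.

(** The classical Nakayama functor Hom_A(M, A)^*, with the left action induced by the right
    multiplications [orbmap a] of A. *)
Definition nakmod : fdmod A := mkmod nakmod_linr nakmod_linl nakmod1 nakmodM.

Let nakmodE a (F : nakmod) : mact nakmod a F = act a F.
Proof. exact: (act_lfunE nakmod_linr nakmod_linl). Qed.

Section Component.
Variables (X : fdmod A) (xi : 'Hom(mor (M : modcat A) X, k^o)).

Let f (x : X) : nakmod := mor_transpose (C := modcat A) M (orbmap x) xi.

Fact nakcomp_lin : linear f.
Proof.
move=> c x y; apply/lfunP => h.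
by rewrite add_lfunE scale_lfunE !mor_transposeE orbmap_linear mcomp_linearl linearP.
Qed.

Fact nakcomp_mact a x : f (mact X a x) = mact nakmod a (f x).
Proof. by rewrite nakmodE /act /f -mor_transpose_comp comp_orbmap orbmapE. Qed.

(** An element x of X is a morphism from A to X, along which [xi] is pulled back to a functional on
    Hom_A(M, A). *)
Definition nakcomp : mor (X : modcat A) nakmod := mkhom nakcomp_lin nakcomp_mact.

Lemma nakcompE x : happ nakcomp x = mor_transpose (C := modcat A) M (orbmap x) xi.
Proof. exact: mkhomE. Qed.

End Component.

Definition nakfam (X : modcat A) :
    'Hom('Hom(mor (M : modcat A) X, k^o), mor X nakmod) :=
  linfun (@nakcomp X).

Lemma nakfamE X xi : nakfam X xi = nakcomp xi.
Proof.
apply: linfunE => c u v; apply: happ_inj => x; rewrite happ_linear !nakcompE.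
apply/lfunP => h.
by rewrite add_lfunE scale_lfunE !mor_transposeE add_lfunE scale_lfunE.
Qed.

Lemma nakfam_nat : nak_family nakfam.
Proof.
move=> X Y f xi; apply: happ_inj => x; rewrite happ_comp !nakfamE !nakcompE.
by rewrite -mor_transpose_comp comp_orbmap.
Qed.

Lemma nakfam_reg_surj (y : mor (regmod A : modcat A) nakmod) :
  exists xi, nakfam (regmod A) xi = y.
Proof.
exists (happ y 1); rewrite nakfamE; apply: happ_inj => a; rewrite nakcompE.
by rewrite -[in RHS](mulr1 a) -regmodE happ_mact nakmodE.
Qed.

Lemma nakfam_reg_inj : injective (nakfam (regmod A)).
Proof.
move=> xi xi' /(congr1 (fun u : mor (regmod A : modcat A) nakmod => happ u 1)).
rewrite !nakfamE !nakcompE.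
by have := nakmod1 xi; have := nakmod1 xi'; rewrite /act => -> ->.
Qed.

(** For P = A this holds because a morphism from A is its value at 1; a dual basis carries it to
    every projective P by naturality. *)
Lemma nakfam_bij (P : modcat A) : projective P -> bijective (nakfam P).
Proof.
move=> /dual_basis[n [b [c bc]]].
have sE (y : mor P nakmod) : exists xi, nakfam P xi = y.
  have [xi xiE] := choice (fun i => nakfam_reg_surj (y ∘ b i)).
  exists (\sum_i mor_transpose (C := modcat A) M (c i) (xi i)).
  rewrite linear_sum -[RHS]mcompm1 -bc mcomp_sumr; apply: eq_bigr => i _.
  by rewrite [LHS]nakfam_nat xiE -!mcompA.
have [g gE] := choice sE.
exists g => // xi; have : lker (nakfam P) == 0%VS; last first.
  by move=> /lker0P; apply; rewrite gE.
apply/lker0P => u v uv; apply/lfunP => h.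
rewrite -[h]mcomp1m -bc mcomp_suml !linear_sum; apply: eq_bigr => i _ /=.
have : mor_transpose (C := modcat A) M (b i) u =
    mor_transpose (C := modcat A) M (b i) v.
  by apply: nakfam_reg_inj; rewrite !nakfam_nat uv.
by move=> /lfunP/(_ (c i ∘ h)); rewrite !mor_transposeE !mcompA.
Qed.

End NakayamaModule.

End ModuleCategory.

(** * Transport along an equivalence *)

Section Transport.
Variables (k : fieldType) (C D : lincat k) (E : linequiv C D).
Local Notation F := (eqv_fun E).
Local Notation G := (eqv_inv E).
Local Notation "'F1'" := (fmap (eqv_fun E)).

Lemma eqv_fun_inj (X Y : C) (f g : mor X Y) : F1 f = F1 g -> f = g.
Proof.
move=> fg; have [e [eK _]] := eqv_eta_iso E Y.
by rewrite -[f]mcomp1m -[g]mcomp1m -eK -!mcompA -!eqv_eta_nat fg.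
Qed.

Lemma eqv_inv_inj (X Y : D) (f g : mor X Y) : fmap G f = fmap G g -> f = g.
Proof.
move=> fg; have [e [_ eK]] := eqv_eps_iso E X.
by rewrite -[f]mcompm1 -[g]mcompm1 -eK !mcompA !eqv_eps_nat fg.
Qed.

(** [linequiv] carries no triangle identities, so the preimage is built from the unit alone and
    checked after applying the faithful functor G. *)
Lemma eqv_fun_full (X Y : C) (h : mor (F X) (F Y)) : exists f, F1 f = h.
Proof.
have [e [eK Ke]] := eqv_eta_iso E Y.
exists (e ∘ fmap G h ∘ eqv_eta E X); apply: eqv_inv_inj.
apply: (iso_epi (eqv_eta_iso E X)).
by rewrite eqv_eta_nat !mcompA Ke mcomp1m.
Qed.

Definition full_inv (X Y : C) : 'Hom(mor (F X) (F Y), mor X Y) := (F1)^-1%VF.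
Arguments full_inv {X Y}.

Lemma full_invK (X Y : C) : cancel (@full_inv X Y) F1.
Proof.
by move=> h; have [f <-] := eqv_fun_full h; rewrite limg_lfunVK ?memv_img ?memvf.
Qed.

Lemma fmapK (X Y : C) : cancel (F1) (@full_inv X Y).
Proof. by apply: lker0_lfunK; apply/lker0P; exact: eqv_fun_inj. Qed.

Definition into N : mor (F (G N)) N := eqv_eps E N.

Definition outof N : mor N (F (G N)) := invmor (eqv_eps E N).

Lemma outof_into N : inverse_of (into N) (outof N).
Proof. exact: invmorP (eqv_eps_iso E N). Qed.

Lemma intoK N : into N ∘ outof N = idmor N.
Proof. by case: (outof_into N). Qed.

Lemma outofK N : outof N ∘ into N = idmor (F (G N)).
Proof. by case: (outof_into N). Qed.

Lemma epi_fmap (X Y : C) (e : mor X Y) : epi e -> epi (F1 e).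
Proof.
move=> ee N g h gh; rewrite -[g]mcomp1m -[h]mcomp1m -intoK -!mcompA.
have [g' g'E] := eqv_fun_full (outof N ∘ g).
have [h' h'E] := eqv_fun_full (outof N ∘ h).
congr (_ ∘ _); rewrite -g'E -h'E; congr (F1 _); apply: ee; apply: eqv_fun_inj.
by rewrite !fmap_comp g'E h'E -!mcompA gh.
Qed.

Lemma fmap_epi (X Y : C) (e : mor X Y) : epi (F1 e) -> epi e.
Proof.
by move=> ee Z g h gh; apply: eqv_fun_inj; apply: ee; rewrite -!fmap_comp gh.
Qed.

Lemma fmap_mono (X Y : C) (e : mor X Y) : mono (F1 e) -> mono e.
Proof.
by move=> ee Z g h gh; apply: eqv_fun_inj; apply: ee; rewrite -!fmap_comp gh.
Qed.

Lemma into_iso N : is_iso (into N). Proof. exact: eqv_eps_iso. Qed.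

Lemma outof_iso N : is_iso (outof N).
Proof. by exists (into N); split; [exact: intoK|exact: outofK]. Qed.

Lemma projective_inv (P : D) : projective P -> projective (G P).
Proof.
move=> pP Y Z e f /epi_fmap ee.
have [u uE] := pP _ _ _ (F1 f ∘ outof P) ee.
have [u' u'E] := eqv_fun_full (u ∘ into P); exists u'; apply: eqv_fun_inj.
by rewrite fmap_comp u'E mcompA uE -mcompA outofK mcompm1.
Qed.

Lemma projective_fun (P : C) : projective P -> projective (F P).
Proof.
move=> pP Y Z e f ee.
have [f' f'E] := eqv_fun_full (outof Z ∘ f).
have [e' e'E] := eqv_fun_full (outof Z ∘ e ∘ into Y).
have ee' : epi e'.
  apply: fmap_epi; rewrite e'E; apply: epi_comp; last exact: iso_epi (into_iso Y).
  by apply: epi_comp => //; apply: iso_epi; exact: outof_iso.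
have [g gE] := pP _ _ _ f' ee'.
exists (into Y ∘ F1 g).
have : F1 (e' ∘ g) = F1 f' by rewrite gE.
rewrite fmap_comp e'E f'E => /(congr1 (fun u => into Z ∘ u)).
by rewrite !mcompA intoK !mcomp1m.
Qed.

Lemma transport_copowers : enough_copowers D -> enough_copowers C.
Proof.
move=> cpD V M; have [T] := cpD V (F M); constructor.
pose to N : 'Hom(mor (G T) N, 'Hom(V, mor M N)) :=
  linfun (fun g => @full_inv M N \o cp_to T (F N) (F1 g ∘ outof T))%VF.
have toE N g : to N g = (@full_inv M N \o cp_to T (F N) (F1 g ∘ outof T))%VF.
  apply: linfunE => a u v; rewrite linearP mcomp_linearl linearP.
  by rewrite comp_lfunDr -comp_lfunZr.
pose tof N (h : 'Hom(V, mor M N)) := full_inv (cp_of T (F1 \o h)%VF ∘ into T).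
have toK N : cancel (to N) (@tof N).
  move=> g; rewrite toE /tof; apply: eqv_fun_inj; rewrite full_invK.
  apply: (iso_epi (outof_iso T)); rewrite -mcompA intoK mcompm1.
  rewrite -[RHS](cp_toK (c := T)); congr (cp_of T _).
  by apply/lfunP => v; rewrite !comp_lfunE full_invK.
have ofK N : cancel (@tof N) (to N).
  move=> h; rewrite toE /tof full_invK -mcompA intoK mcompm1 cp_ofK.
  by apply/lfunP => v; rewrite !comp_lfunE fmapK.
apply: (@Copower k C V M (G T) to tof toK ofK) => N N' h g v.
apply: eqv_fun_inj; rewrite fmap_comp !toE !comp_lfunE !full_invK.
by rewrite fmap_comp -mcompA cp_nat.
Qed.

Lemma transport_presentations :
  enough_presentations D -> enough_presentations C.
Proof.
move=> prD X; have [P [Q [p [q [pP pQ ep pq univ]]]]] := prD (F X).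
have [p' p'E] := eqv_fun_full (p ∘ into P).
have [q' q'E] := eqv_fun_full (outof P ∘ q ∘ into Q).
exists (G P), (G Q), p', q'; split; try exact: projective_inv.
- apply: fmap_epi; rewrite p'E; apply: epi_comp => //; exact: iso_epi (into_iso P).
- apply: eqv_fun_inj; rewrite fmap_comp p'E q'E linear0.
  by rewrite -!mcompA (mcompA (into P)) intoK mcomp1m mcompA pq mcomp0m.
move=> T h hq.
have [g gE] : exists g, g ∘ p = F1 h ∘ outof P.
  apply: univ; apply: (iso_epi (into_iso Q)).
  by rewrite -!mcompA (mcompA (outof P)) -q'E -fmap_comp hq linear0 mcomp0m.
have [g' g'E] := eqv_fun_full g; exists g'; apply: eqv_fun_inj.
by rewrite fmap_comp g'E p'E mcompA gE -mcompA outofK mcompm1.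
Qed.

Lemma transport_images :
  (forall (X Y : D) (f : mor X Y), exists I (p : mor X I) (i : mor I Y),
     [/\ epi p, mono i & i ∘ p = f]) ->
  forall (X Y : C) (f : mor X Y), exists I (p : mor X I) (i : mor I Y),
     [/\ epi p, mono i & i ∘ p = f].
Proof.
move=> imD X Y f; have [I [p [i [ep mi ip]]]] := imD _ _ (F1 f).
have [p' p'E] := eqv_fun_full (outof I ∘ p).
have [i' i'E] := eqv_fun_full (i ∘ into I).
exists (G I), p', i'; split.
- apply: fmap_epi; rewrite p'E; apply: epi_comp => //.
  exact: iso_epi (outof_iso I).
- apply: fmap_mono; rewrite i'E; apply: mono_comp => //.
  exact: iso_mono (into_iso I).
- apply: eqv_fun_inj; rewrite fmap_comp p'E i'E.
  by rewrite -mcompA (mcompA (into I)) intoK mcomp1m.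
Qed.

(** Full faithfulness turns a functional on Hom(M, X) into one on Hom(F M, F X); the family of D at
    F M is applied to it and its value carried back. *)
Lemma transport_nak_family :
  (forall M : D, exists T (i : forall X, 'Hom('Hom(mor M X, k^o), mor X T)),
     nak_family i /\ forall P, projective P -> bijective (i P)) ->
  forall M : C, exists T (i : forall X, 'Hom('Hom(mor M X, k^o), mor X T)),
     nak_family i /\ forall P, projective P -> bijective (i P).
Proof.
move=> nakD M; have [T [i [nat_i bij_i]]] := nakD (F M).
pose push X (xi : 'Hom(mor M X, k^o)) : 'Hom(mor (F M) (F X), k^o) :=
  (xi \o @full_inv M X)%VF.
pose i' X : 'Hom('Hom(mor M X, k^o), mor X (G T)) :=
  linfun (fun xi => full_inv (outof T ∘ i (F X) (push X xi))).
have i'E X xi : i' X xi = full_inv (outof T ∘ i (F X) (push X xi)).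
  apply: linfunE => a u v; rewrite /push comp_lfunDl -comp_lfunZl linearP.
  by rewrite mcomp_linearr linearP.
exists (G T), i'; split.
- move=> X Y f xi; rewrite !i'E; apply: eqv_fun_inj.
  rewrite fmap_comp !full_invK -mcompA -nat_i; congr (_ ∘ i _ _).
  apply/lfunP => g; rewrite mor_transposeE /push !comp_lfunE mor_transposeE.
  by congr (xi _); apply: eqv_fun_inj; rewrite fmap_comp !full_invK.
- move=> P pP; have [j iK Ki] := bij_i _ (projective_fun pP).
  exists (fun y => (j (into T ∘ F1 y) \o F1)%VF).
    move=> xi; rewrite i'E full_invK mcompA intoK mcomp1m iK.
    by apply/lfunP => g; rewrite /push !comp_lfunE fmapK.
  move=> y; rewrite i'E; apply: eqv_fun_inj; rewrite full_invK.
  have -> : push P (j (into T ∘ F1 y) \o F1)%VF = j (into T ∘ F1 y).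
    by apply/lfunP => g; rewrite /push !comp_lfunE full_invK.
  by rewrite Ki mcompA outofK mcomp1m.
Qed.

End Transport.

(** * Consequences for finite abelian categories *)

Section FiniteAbelian.
Variables (k : fieldType) (C : lincat k).
Hypothesis finC : finite_abelian C.

Lemma finite_copowers : enough_copowers C.
Proof.
by have [A [E]] := finC; apply: (transport_copowers E); exact: modcat_copowers.
Qed.

Lemma finite_presentations : enough_presentations C.
Proof.
by have [A [E]] := finC; apply: (transport_presentations E);
  exact: modcat_presentations.
Qed.

Lemma finite_images (X Y : C) (f : mor X Y) :
  exists I (p : mor X I) (i : mor I Y), [/\ epi p, mono i & i ∘ p = f].
Proof.
by have [A [E]] := finC; apply: (transport_images E); exact: modcat_images.
Qed.

Lemma finite_nak_family (M : C) :
  exists T (i : forall X, 'Hom('Hom(mor M X, k^o), mor X T)),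
    nak_family i /\ forall P, projective P -> bijective (i P).
Proof.
have [A [E]] := finC; apply: (transport_nak_family E) => N.
exists (nakmod N), (nakfam N); split; [exact: nakfam_nat|exact: nakfam_bij].
Qed.

(** Two universal families differ by an isomorphism of their targets, and one that is bijective on
    projectives is known to exist. *)
Lemma universal_proj_bij M T (i : forall X, 'Hom('Hom(mor M X, k^o), mor X T)) :
  nak_family i -> nak_universal i -> forall P : C, projective P -> bijective (i P).
Proof.
move=> nat_i univ_i; have [T' [j [nat_j bij_j]]] := finite_nak_family M.
have univ_j := proj_bij_universal finite_presentations nat_j bij_j.
have [g [gE _]] := univ_i _ _ nat_j; have [h [hE _]] := univ_j _ _ nat_i.
have hg : h ∘ g = idmor T.
  have [u [_ uU]] := univ_i _ _ nat_i.
  rewrite -(uU (h ∘ g)); last by move=> X xi; rewrite -mcompA gE hE.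
  by apply: uU => X xi; rewrite mcomp1m.
have gh : g ∘ h = idmor T'.
  have [u [_ uU]] := univ_j _ _ nat_j.
  rewrite -(uU (g ∘ h)); last by move=> X xi; rewrite -mcompA hE gE.
  by apply: uU => X xi; rewrite mcomp1m.
move=> P pP; have [j' jK Kj] := bij_j P pP.
exists (fun y => j' (g ∘ y)) => [xi|y]; first by rewrite gE jK.
by rewrite -hE Kj mcompA hg mcomp1m.
Qed.

End FiniteAbelian.

(** * Strictness of the tensor product *)

Reserved Notation "X ◁ f" (at level 40, left associativity).
Reserved Notation "f ▷ Z" (at level 40, left associativity).

Section Pack.
Variables (k : fieldType) (C : lincat k).
Implicit Types X Y Z : C.

(* Morphisms with their source and target: equality of packed morphisms is
   equality up to the transports eqm. *)
Definition pmor := {X : C & {Y : C & mor X Y}}.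
Definition pack X Y (f : mor X Y) : pmor := existT _ X (existT _ Y f).
Definition pdom (a : pmor) : C := projT1 a.
Definition pcod (a : pmor) : C := projT1 (projT2 a).
Definition unpack (a : pmor) : mor (pdom a) (pcod a) := projT2 (projT2 a).

Lemma existT_inj (T : Type) (B : T -> Type) a (x y : B a) :
  existT B a x = existT B a y -> x = y.
Proof.
by move=> e; move: (projT2_eq e); rewrite (Prop_irrelevance (projT1_eq e) (erefl a)).
Qed.

Lemma pack_inj X Y (f g : mor X Y) : pack f = pack g -> f = g.
Proof. by move=> fg; exact: (existT_inj (existT_inj fg)). Qed.

(** For ends that do not match the value [b] is arbitrary; [pack_comp] concerns composable
    morphisms. *)
Definition pkcomp (b a : pmor) : pmor :=
  if pselect (pcod a = pdom b) is left e
  then pack (unpack b ∘ (eqm e ∘ unpack a)) else b.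

Lemma pack_comp X Y Z (g : mor Y Z) (f : mor X Y) :
  pack (g ∘ f) = pkcomp (pack g) (pack f).
Proof.
rewrite /pkcomp; case: pselect => [e|] //=; rewrite /unpack /=.
by rewrite (Prop_irrelevance e erefl) /= mcomp1m.
Qed.

Definition pid X : pmor := pack (idmor X).

Lemma pack_eqm X Y (e : X = Y) : pack (eqm e) = pid X.
Proof. by case: Y / e. Qed.

Lemma pack_eqml X Y Z (e : Y = Z) (f : mor X Y) : pack (eqm e ∘ f) = pack f.
Proof. by case: Z / e; rewrite /= mcomp1m. Qed.

Lemma pack_eqmr X Y Z (e : X = Y) (f : mor Y Z) : pack (f ∘ eqm e) = pack f.
Proof. by case: Y / e f => f; rewrite /= mcompm1. Qed.

Lemma pkcomp1l X Y (f : mor X Y) : pkcomp (pid Y) (pack f) = pack f.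
Proof. by rewrite -pack_comp mcomp1m. Qed.

Lemma pkcomp1r X Y (f : mor X Y) : pkcomp (pack f) (pid X) = pack f.
Proof. by rewrite -pack_comp mcompm1. Qed.

Lemma eqmK X Y (e : X = Y) (e' : Y = X) : eqm e' ∘ eqm e = idmor X.
Proof. by case: Y / e e' => e'; rewrite (Prop_irrelevance e' erefl) mcomp1m. Qed.

Lemma eqm_iso X Y (e : X = Y) : is_iso (eqm e).
Proof. by exists (eqm (esym e)); split; exact: eqmK. Qed.

End Pack.

Section PackTensor.
Variables (k : fieldType) (C : lincat k) (m : monoidal C).
Implicit Types X Y Z : C.
Local Notation I := (tunit m).
Local Notation "X ⊗ Y" := (tens (m := m) X Y) : lincat_scope.
Local Notation "f ⊗m g" := (tensm (m := m) f g) : lincat_scope.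
Local Notation "X ◁ f" := (tensm (m := m) (idmor X) f) : lincat_scope.
Local Notation "f ▷ Z" := (tensm (m := m) f (idmor Z)) : lincat_scope.

Definition ptens (a b : pmor C) : pmor C :=
  pack (tensm (m := m) (unpack a) (unpack b)).

Lemma pack_tens X X' Y Y' (f : mor X X') (g : mor Y Y') :
  pack (f ⊗m g) = ptens (pack f) (pack g).
Proof. by []. Qed.

Lemma ptens_id X Y : ptens (pid X) (pid Y) = pid (X ⊗ Y).
Proof. by rewrite -pack_tens tensm_id. Qed.

(** Packing absorbs the transports of [tensmA], so the strict associativity becomes an equation
    without constraints. *)
Lemma ptensA a b c : ptens a (ptens b c) = ptens (ptens a b) c.
Proof.
case: a b c => [X [X' f]] [Y [Y' g]] [Z [Z' h]].
rewrite -!pack_tens /unpack /=.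
by rewrite -(pack_eqml (tensA m X' Y' Z')) tensmA pack_eqmr.
Qed.

Lemma ptens1l a : ptens (pid I) a = a.
Proof.
case: a => [X [X' f]]; rewrite -[existT _ _ _]/(pack f) -pack_tens.
by rewrite -(pack_eqml (tens1o m X')) tens1m pack_eqmr.
Qed.

Lemma ptens1r a : ptens a (pid I) = a.
Proof.
case: a => [X [X' f]]; rewrite -[existT _ _ _]/(pack f) -pack_tens.
by rewrite -(pack_eqml (tenso1 m X')) tensm1 pack_eqmr.
Qed.

Lemma eqm_sr X Y Z (e : X = Y) :
  tensm (m := m) (eqm e) (idmor Z) = eqm (congr1 (fun W => W ⊗ Z) e).
Proof. by case: Y / e; rewrite /= tensm_id. Qed.

Lemma eqm_sl X Y Z (e : X = Y) :
  tensm (m := m) (idmor Z) (eqm e) = eqm (congr1 (fun W => Z ⊗ W) e).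
Proof. by case: Y / e; rewrite /= tensm_id. Qed.

Lemma sr_comp X Y Z W (g : mor Y Z) (f : mor X Y) :
  (g ∘ f) ▷ W = g ▷ W ∘ (f ▷ W).
Proof. by rewrite -tensm_comp mcompm1. Qed.

Lemma sl_comp X Y Z W (g : mor Y Z) (f : mor X Y) :
  W ◁ (g ∘ f) = W ◁ g ∘ (W ◁ f).
Proof. by rewrite -tensm_comp mcompm1. Qed.

Lemma slsr X X' Y Y' (f : mor X X') (g : mor Y Y') :
  tensm (m := m) (idmor X') g ∘ (f ▷ Y) = (f ▷ Y') ∘ (X ◁ g).
Proof. by rewrite -!tensm_comp !mcompm1 !mcomp1m. Qed.

Lemma tensm_split X X' Y Y' (f : mor X X') (g : mor Y Y') :
  f ⊗m g = (f ▷ Y') ∘ (X ◁ g).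
Proof. by rewrite -!tensm_comp !mcompm1 !mcomp1m. Qed.

(** Reduces an identity of morphisms to its version with a spectator strand. *)
Lemma sr_inj X Y (f g : mor X Y) : f ▷ I = g ▷ I -> f = g.
Proof.
by move=> /(congr1 (@pack k C _ _)); rewrite !pack_tens !ptens1r => /pack_inj.
Qed.

(** * Morphisms acting on the first strands of a tensor product *)

(* With objects nested to the right and a spectator Z, no unit or associativity
   constraint occurs in the identities between these morphisms.  They are locked
   so that rewriting with mcompA does not unfold them. *)
Fact lift_key : unit. Proof. exact: tt. Qed.

Definition lift22 A B A' B' (f : mor (A ⊗ B) (A' ⊗ B')) Z :
  mor (A ⊗ (B ⊗ Z)) (A' ⊗ (B' ⊗ Z)) :=
  locked_with lift_key (assocV A' B' Z ∘ (f ▷ Z) ∘ assoc A B Z).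

Definition lift20 A B (e : mor (A ⊗ B) I) Z : mor (A ⊗ (B ⊗ Z)) Z :=
  locked_with lift_key (lunit Z ∘ (e ▷ Z) ∘ assoc A B Z).

Definition lift02 A B (c : mor I (A ⊗ B)) Z : mor Z (A ⊗ (B ⊗ Z)) :=
  locked_with lift_key (assocV A B Z ∘ (c ▷ Z) ∘ lunitV Z).

Lemma pack_lift22 A B A' B' (f : mor (A ⊗ B) (A' ⊗ B')) Z :
  pack (lift22 f Z) = ptens (pack f) (pid Z).
Proof. by rewrite /lift22 locked_withE pack_eqmr pack_eqml. Qed.

Lemma pack_lift20 A B (e : mor (A ⊗ B) I) Z :
  pack (lift20 e Z) = ptens (pack e) (pid Z).
Proof. by rewrite /lift20 locked_withE pack_eqmr pack_eqml. Qed.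

Lemma pack_lift02 A B (c : mor I (A ⊗ B)) Z :
  pack (lift02 c Z) = ptens (pack c) (pid Z).
Proof. by rewrite /lift02 locked_withE pack_eqmr pack_eqml. Qed.

Definition packE := (pack_eqml, pack_eqmr, pack_comp, pack_lift22, pack_lift20,
  pack_lift02, pack_tens, pack_eqm).

Lemma psl2 A B X Y (g : mor X Y) :
  ptens (pid A) (ptens (pid B) (pack g)) = pack ((A ⊗ B) ◁ g).
Proof. by rewrite ptensA ptens_id -pack_tens. Qed.

Lemma lift22_nat A B A' B' (f : mor (A ⊗ B) (A' ⊗ B')) Z Z' (g : mor Z Z') :
  (A' ◁ (B' ◁ g)) ∘ lift22 f Z = lift22 f Z' ∘ (A ◁ (B ◁ g)).
Proof.
apply: pack_inj; rewrite !packE !psl2 -!pack_tens -!pack_comp slsr.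
by [].
Qed.

Lemma lift20_nat A B (f : mor (A ⊗ B) I) Z Z' (g : mor Z Z') :
  g ∘ lift20 f Z = lift20 f Z' ∘ (A ◁ (B ◁ g)).
Proof.
apply: pack_inj; rewrite !packE !psl2 -{1}(ptens1l (pack g)) -!pack_tens -!pack_comp.
by rewrite slsr.
Qed.

Lemma lift02_nat A B (f : mor I (A ⊗ B)) Z Z' (g : mor Z Z') :
  (A ◁ (B ◁ g)) ∘ lift02 f Z = lift02 f Z' ∘ g.
Proof.
apply: pack_inj; rewrite !packE !psl2 -{1}(ptens1l (pack g)) -!pack_tens -!pack_comp.
by rewrite slsr.
Qed.

Lemma lift22_comp A B A' B' A'' B'' (g : mor (A' ⊗ B') (A'' ⊗ B''))
    (f : mor (A ⊗ B) (A' ⊗ B')) Z : lift22 (g ∘ f) Z = lift22 g Z ∘ lift22 f Z.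
Proof.
apply: pack_inj; rewrite [in RHS]pack_comp !pack_lift22.
by rewrite -!pack_tens -!pack_comp sr_comp.
Qed.

Lemma lift20_comp A B A' B' (g : mor (A' ⊗ B') I)
    (f : mor (A ⊗ B) (A' ⊗ B')) Z : lift20 (g ∘ f) Z = lift20 g Z ∘ lift22 f Z.
Proof.
apply: pack_inj; rewrite [in RHS]pack_comp !(pack_lift20, pack_lift22).
by rewrite -!pack_tens -!pack_comp sr_comp.
Qed.

Lemma lift02_comp A B A' B' (g : mor (A ⊗ B) (A' ⊗ B'))
    (f : mor I (A ⊗ B)) Z : lift02 (g ∘ f) Z = lift22 g Z ∘ lift02 f Z.
Proof.
apply: pack_inj; rewrite [in RHS]pack_comp !(pack_lift02, pack_lift22).
by rewrite -!pack_tens -!pack_comp sr_comp.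
Qed.

Lemma lift22_id A B Z : lift22 (idmor (A ⊗ B)) Z = idmor (A ⊗ (B ⊗ Z)).
Proof.
by apply: pack_inj; rewrite pack_lift22 -!/(pid _) ptens_id -!ptens_id ptensA.
Qed.

Lemma lift22_sr A B A' (f : mor A A') Z :
  lift22 (f ▷ B) Z = f ▷ (B ⊗ Z).
Proof.
by apply: pack_inj; rewrite pack_lift22 !pack_tens -!/(pid _) -ptens_id ptensA.
Qed.

Lemma lift22_sl A B B' (f : mor B B') Z :
  lift22 (A ◁ f) Z = A ◁ (f ▷ Z).
Proof. by apply: pack_inj; rewrite pack_lift22 !pack_tens ptensA. Qed.

End PackTensor.
Arguments slsr {k C m X X' Y Y'} f g.
Arguments sr_comp {k C m X Y Z} W g f.
Arguments sl_comp {k C m X Y Z} W g f.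

(** * Sliding strands through the braiding *)

Section Braided.
Variables (k : fieldType) (C : lincat k) (m : monoidal C) (s : braiding m).
Implicit Types X Y Z W A B : C.
Local Notation I := (tunit m).
Local Notation "X ⊗ Y" := (tens (m := m) X Y) : lincat_scope.
Local Notation "f ⊗m g" := (tensm (m := m) f g) : lincat_scope.
Local Notation "X ◁ f" := (tensm (m := m) (idmor X) f) : lincat_scope.
Local Notation "f ▷ Z" := (tensm (m := m) f (idmor Z)) : lincat_scope.

Definition bz X Y Z : mor (X ⊗ (Y ⊗ Z)) (Y ⊗ (X ⊗ Z)) := lift22 (braid s X Y) Z.
Definition bzi X Y Z : mor (Y ⊗ (X ⊗ Z)) (X ⊗ (Y ⊗ Z)) :=
  lift22 (invmor (braid s X Y)) Z.

Lemma bzK X Y Z : bzi X Y Z ∘ bz X Y Z = idmor (X ⊗ (Y ⊗ Z)).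
Proof.
rewrite -lift22_comp; have [-> _] := invmorP (braid_iso s X Y).
exact: lift22_id.
Qed.

Lemma bziK X Y Z : bz X Y Z ∘ bzi X Y Z = idmor (Y ⊗ (X ⊗ Z)).
Proof.
rewrite -lift22_comp; have [_ ->] := invmorP (braid_iso s X Y).
exact: lift22_id.
Qed.

Lemma bz_nat1 X X' Y Z (f : mor X X') :
  bz X' Y Z ∘ (f ▷ (Y ⊗ Z)) = (Y ◁ (f ▷ Z)) ∘ bz X Y Z.
Proof. by rewrite /bz -lift22_sr -lift22_sl -!lift22_comp braid_nat. Qed.

Lemma bz_nat2 X Y Y' Z (f : mor Y Y') :
  bz X Y' Z ∘ (X ◁ (f ▷ Z)) = (f ▷ (X ⊗ Z)) ∘ bz X Y Z.
Proof. by rewrite /bz -lift22_sr -lift22_sl -!lift22_comp braid_nat. Qed.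

Lemma bz_nat3 X Y Z Z' (f : mor Z Z') :
  bz X Y Z' ∘ (X ◁ (Y ◁ f)) = (Y ◁ (X ◁ f)) ∘ bz X Y Z.
Proof. by rewrite /bz lift22_nat. Qed.

(** [b2] is the braiding of W with A (x) B and [b2'] that of A (x) B with W, each split into two
    crossings by a hexagon. *)
Definition b2 W A B Z : mor (W ⊗ (A ⊗ (B ⊗ Z))) (A ⊗ (B ⊗ (W ⊗ Z))) :=
  (A ◁ bz W B Z) ∘ bz W A (B ⊗ Z).

Definition b2' W A B Z : mor (A ⊗ (B ⊗ (W ⊗ Z))) (W ⊗ (A ⊗ (B ⊗ Z))) :=
  bz A W (B ⊗ Z) ∘ (A ◁ bz B W Z).

Lemma pack_b2 W A B Z :
  pack (b2 W A B Z) = ptens m (pack (braid s W (A ⊗ B))) (pid Z).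
Proof.
rewrite -(pack_tens m _ (idmor Z)) braid_tensr !sr_comp /assoc /assocV !eqm_sr.
by rewrite /b2 /bz !packE -!/(pid _) -!ptens_id !ptensA.
Qed.

Lemma pack_b2' W A B Z :
  pack (b2' W A B Z) = ptens m (pack (braid s (A ⊗ B) W)) (pid Z).
Proof.
rewrite -(pack_tens m _ (idmor Z)) braid_tensl !sr_comp /assoc /assocV !eqm_sr.
by rewrite /b2' /bz !packE -!/(pid _) -!ptens_id !ptensA.
Qed.

Lemma idem_iso X Y (f : mor X Y) (e : Y = X) :
  is_iso f -> f ∘ eqm e ∘ f = f -> pack f = pid X.
Proof.
case: X / e f => f [g [gf _]] ff.
by rewrite -[f]mcomp1m -gf -mcompA -[X in g ∘ (X ∘ _)]mcompm1 ff gf.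
Qed.

(** The hexagon at I (x) I makes the braiding with I idempotent up to transports, and an invertible
    idempotent is an identity. *)
Lemma pack_braid1 W : pack (braid s W I) = pid (W ⊗ I).
Proof.
apply: (idem_iso (e := etrans (tens1o m W) (esym (tenso1 m W)))).
  exact: braid_iso.
apply: pack_inj; have : pack (braid s W (I ⊗ I)) = pack (braid s W I).
  by rewrite (tens1o m I).
move=> <-; rewrite braid_tensr /assoc /assocV -mcompA !packE.
by rewrite -!/(pid _) ptens1l ptens1r.
Qed.

Lemma pack_braid1' W : pack (braid s I W) = pid (I ⊗ W).
Proof.
apply: (idem_iso (e := etrans (tenso1 m W) (esym (tens1o m W)))).
  exact: braid_iso.
apply: pack_inj; have : pack (braid s (I ⊗ I) W) = pack (braid s I W).
  by rewrite (tens1o m I).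
move=> <-; rewrite braid_tensl /assoc /assocV -mcompA !packE.
by rewrite -!/(pid _) ptens1l ptens1r.
Qed.

Lemma pid_unit W : pid (W ⊗ I) = pid (I ⊗ W).
Proof. by rewrite -!ptens_id ptens1l ptens1r. Qed.

Lemma slide22 W A B A' B' (f : mor (A ⊗ B) (A' ⊗ B')) Z :
  b2 W A' B' Z ∘ (W ◁ lift22 f Z) = lift22 f (W ⊗ Z) ∘ b2 W A B Z.
Proof.
apply: pack_inj; rewrite 2!pack_comp !pack_b2 pack_lift22 pack_tens pack_lift22.
rewrite -!ptens_id !ptensA -!pack_tens -!pack_comp.
by rewrite -!sr_comp braid_nat.
Qed.

Lemma slide22' W A B A' B' (f : mor (A ⊗ B) (A' ⊗ B')) Z :
  b2' W A' B' Z ∘ lift22 f (W ⊗ Z) = (W ◁ lift22 f Z) ∘ b2' W A B Z.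
Proof.
apply: pack_inj; rewrite 2!pack_comp !pack_b2' pack_lift22 pack_tens pack_lift22.
rewrite -!ptens_id !ptensA -!pack_tens -!pack_comp.
by rewrite -!sr_comp braid_nat.
Qed.

Lemma pack_sl_lift20 W A B (e : mor (A ⊗ B) I) Z :
  pack (W ◁ lift20 e Z) = pack ((W ◁ e) ▷ Z).
Proof. by rewrite !packE ptensA. Qed.

(** Naturality of the braiding in A (x) B, together with the triviality of the braiding with the
    unit. *)
Lemma slide20 W A B (e : mor (A ⊗ B) I) Z :
  W ◁ lift20 e Z = lift20 e (W ⊗ Z) ∘ b2 W A B Z.
Proof.
apply: pack_inj; rewrite pack_comp pack_b2 pack_lift20 pack_sl_lift20.
rewrite -ptens_id ptensA -!pack_tens -pack_comp -sr_comp.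
rewrite -(braid_nat s (idmor W) e) sr_comp pack_comp.
by rewrite (pack_tens m (braid s W I)) pack_braid1 ptens_id pkcomp1l.
Qed.

Lemma slide20' W A B (e : mor (A ⊗ B) I) Z :
  lift20 e (W ⊗ Z) = (W ◁ lift20 e Z) ∘ b2' W A B Z.
Proof.
apply: pack_inj; rewrite pack_comp pack_b2' pack_lift20 pack_sl_lift20.
rewrite -ptens_id ptensA -!pack_tens -pack_comp -sr_comp.
rewrite -(braid_nat s e (idmor W)) sr_comp pack_comp.
by rewrite (pack_tens m (braid s I W)) pack_braid1' ptens_id pkcomp1l.
Qed.

Lemma pack_sl_lift02 W A B (e : mor I (A ⊗ B)) Z :
  pack (W ◁ lift02 e Z) = pack ((W ◁ e) ▷ Z).
Proof. by rewrite !packE ptensA. Qed.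

Lemma slide02 W A B (c : mor I (A ⊗ B)) Z :
  b2 W A B Z ∘ (W ◁ lift02 c Z) = lift02 c (W ⊗ Z).
Proof.
apply: pack_inj; rewrite pack_comp pack_b2 pack_lift02 pack_sl_lift02.
rewrite -ptens_id ptensA -!pack_tens -pack_comp -sr_comp.
rewrite (braid_nat s (idmor W) c) sr_comp pack_comp.
by rewrite (pack_tens m (braid s W I)) pack_braid1 pid_unit ptens_id pkcomp1r.
Qed.

Lemma slide02' W A B (c : mor I (A ⊗ B)) Z :
  W ◁ lift02 c Z = b2' W A B Z ∘ lift02 c (W ⊗ Z).
Proof.
apply: pack_inj; rewrite pack_comp pack_b2' pack_lift02 pack_sl_lift02.
rewrite -ptens_id ptensA -!pack_tens -pack_comp -sr_comp.
rewrite (braid_nat s c (idmor W)) sr_comp pack_comp.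
by rewrite (pack_tens m (braid s I W)) pack_braid1' -pid_unit ptens_id pkcomp1r.
Qed.

Lemma bz_iso X Y Z : is_iso (bz X Y Z).
Proof. by exists (bzi X Y Z); split; [exact: bzK | exact: bziK]. Qed.

(** This is the slide of the braiding of A and B, as a morphism on two strands, past W. *)
Lemma bz_yang_baxter A B W Z :
  (W ◁ bz A B Z) ∘ b2' W A B Z = b2' W B A Z ∘ bz A B (W ⊗ Z).
Proof. by rewrite /bz slide22'. Qed.

End Braided.

(** * Duality *)

Section Duality.
Variables (k : fieldType) (C : lincat k) (m : monoidal C) (d : rigid m).
Implicit Types X Y Z W A B : C.
Local Notation I := (tunit m).
Local Notation "X ⊗ Y" := (tens (m := m) X Y) : lincat_scope.
Local Notation "f ⊗m g" := (tensm (m := m) f g) : lincat_scope.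
Local Notation "X ◁ f" := (tensm (m := m) (idmor X) f) : lincat_scope.
Local Notation "f ▷ Z" := (tensm (m := m) f (idmor Z)) : lincat_scope.
Local Notation "X ^*" := (ldual d X) : lincat_scope.

Definition evz X Z : mor (X^* ⊗ (X ⊗ Z)) Z := lift20 (ev d X) Z.
Definition coz X Z : mor Z (X ⊗ (X^* ⊗ Z)) := lift02 (coev d X) Z.
Definition evrz X Z : mor (X ⊗ (rdual d X ⊗ Z)) Z := lift20 (evr d X) Z.
Definition corz X Z : mor Z (rdual d X ⊗ (X ⊗ Z)) := lift02 (coevr d X) Z.

Lemma zigzag X Z : (X ◁ evz X Z) ∘ coz X (X ⊗ Z) = idmor (X ⊗ Z).
Proof.
have e : pack (_ ▷ Z) = pack (idmor _ ▷ Z) :=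
  congr1 (fun f => pack (f ▷ Z)) (ldual_zigzag d X).
apply: pack_inj; rewrite -[in RHS]tensm_id -{}e !sr_comp.
rewrite /lunitV /runit /assocV !eqm_sr.
by rewrite /evz /coz !packE -!/(pid _) -!ptens_id !ptensA.
Qed.

Lemma zagzig X Z : evz X (X^* ⊗ Z) ∘ (X^* ◁ coz X Z) = idmor (X^* ⊗ Z).
Proof.
have e : pack (_ ▷ Z) = pack (idmor _ ▷ Z) :=
  congr1 (fun f => pack (f ▷ Z)) (ldual_zagzig d X).
apply: pack_inj; rewrite -[in RHS]tensm_id -{}e !sr_comp.
rewrite /runitV /lunit /assoc !eqm_sr.
by rewrite /evz /coz !packE -!/(pid _) -!ptens_id !ptensA.
Qed.

Lemma rzigzag X Z : evrz X (X ⊗ Z) ∘ (X ◁ corz X Z) = idmor (X ⊗ Z).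
Proof.
have e : pack (_ ▷ Z) = pack (idmor _ ▷ Z) :=
  congr1 (fun f => pack (f ▷ Z)) (rdual_zigzag d X).
apply: pack_inj; rewrite -[in RHS]tensm_id -{}e !sr_comp.
rewrite /runitV /lunit /assoc !eqm_sr.
by rewrite /evrz /corz !packE -!/(pid _) -!ptens_id !ptensA.
Qed.

Lemma evz_nat X Z Z' (g : mor Z Z') : g ∘ evz X Z = evz X Z' ∘ (X^* ◁ (X ◁ g)).
Proof. exact: lift20_nat. Qed.

Lemma coz_nat X Z Z' (g : mor Z Z') : (X ◁ (X^* ◁ g)) ∘ coz X Z = coz X Z' ∘ g.
Proof. exact: lift02_nat. Qed.

(** Inserting the zigzag identity of [coz] below [c] and commuting the two by naturality lets the
    hypothesis cancel [c]. *)
Lemma copairing_unique A Z (c : forall Z, mor Z (A ⊗ (A^* ⊗ Z))) :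
  (forall Z Z' (g : mor Z Z'), (A ◁ (A^* ◁ g)) ∘ c Z = c Z' ∘ g) ->
  (forall Z, (A ◁ evz A Z) ∘ c (A ⊗ Z) = idmor (A ⊗ Z)) ->
  c Z = coz A Z.
Proof.
move=> c_nat c_zig; rewrite -[c Z]mcomp1m -tensm_id -zagzig sl_comp -mcompA.
by rewrite c_nat mcompA c_zig mcomp1m.
Qed.

Lemma pack_evz_tens X Y Z :
  pack (evz (X ⊗ Y) Z) = pack (evz Y Z ∘ (Y^* ◁ evz X (Y ⊗ Z))).
Proof.
rewrite /evz pack_lift20 ev_tens -(pack_tens m _ (idmor Z)) !sr_comp.
rewrite /runit /assocV /assoc !eqm_sr.
by rewrite !packE -!/(pid _) -!ptens_id !ptensA.
Qed.

Definition tens2_cast X Y Z :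
    X ⊗ (Y ⊗ (Y^* ⊗ (X^* ⊗ Z))) = (X ⊗ Y) ⊗ ((X ⊗ Y)^* ⊗ Z).
Proof. by rewrite ldual_tens -!tensA. Qed.

Definition tens2_castV X Y Z :
    Y^* ⊗ (X^* ⊗ (X ⊗ (Y ⊗ Z))) = (X ⊗ Y)^* ⊗ ((X ⊗ Y) ⊗ Z).
Proof. by rewrite ldual_tens -!tensA. Qed.

Lemma evz_tens X Y Z :
  evz (X ⊗ Y) Z ∘ eqm (tens2_castV X Y Z) = evz Y Z ∘ (Y^* ◁ evz X (Y ⊗ Z)).
Proof. by apply: pack_inj; rewrite pack_eqmr pack_evz_tens. Qed.

(** Strictness of duality is given for [ev] only; the nested copairing is inverse to the nested
    [evz], so uniqueness of copairings gives the result. *)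
Lemma coz_tens X Y Z :
  coz (X ⊗ Y) Z = eqm (tens2_cast X Y Z) ∘ ((X ◁ coz Y (X^* ⊗ Z)) ∘ coz X Z).
Proof.
pose c W := eqm (tens2_cast X Y W) ∘ ((X ◁ coz Y (X^* ⊗ W)) ∘ coz X W).
symmetry; apply: (@copairing_unique _ _ c) => [W W' g|W]; apply: pack_inj.
  transitivity (pack ((X ◁ (Y ◁ (Y^* ◁ (X^* ◁ g)))) ∘
    ((X ◁ coz Y (X^* ⊗ W)) ∘ coz X W))).
    rewrite [RHS]pack_comp pack_comp pack_eqml; congr (pkcomp _ _).
    rewrite !pack_tens -!/(pid _) -ptens_id ldual_tens -ptens_id.
    by rewrite !ptensA.
  rewrite !mcompA -[in LHS]sl_comp coz_nat sl_comp -(mcompA (X ◁ _)) coz_nat.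
  by rewrite [RHS]pack_comp pack_eqml -pack_comp !mcompA.
rewrite /c pack_comp pack_tens pack_evz_tens pack_eqml.
have -> : pack ((X ◁ coz Y (X^* ⊗ ((X ⊗ Y) ⊗ W))) ∘ coz X ((X ⊗ Y) ⊗ W)) =
    pack ((X ◁ coz Y (X^* ⊗ (X ⊗ (Y ⊗ W)))) ∘ coz X (X ⊗ (Y ⊗ W))).
  by rewrite -tensA.
rewrite -[pack (idmor (X ⊗ Y))]/(pid _) -ptens_id -ptensA -!pack_tens -pack_comp.
rewrite sl_comp sl_comp !mcompA -(mcompA _ (X ◁ (Y ◁ _))) -[X in _ ∘ X ∘ _]sl_comp.
rewrite coz_nat -sl_comp mcompA zigzag mcomp1m zigzag.
by rewrite -/(pid _) tensA.
Qed.

End Duality.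

(** * Rewriting inside composites nested to the right *)

Section Reassoc.
Variables (k : fieldType) (C : lincat k).

Lemma rea X Y Y' Z T (g : mor Y Z) (f : mor X Y) (g' : mor Y' Z) (f' : mor X Y')
    (h : mor (T : C) X) : g ∘ f = g' ∘ f' -> g ∘ (f ∘ h) = g' ∘ (f' ∘ h).
Proof. by move=> e; rewrite !mcompA e. Qed.

Lemma rea1 X Y Z T (g : mor Y Z) (f : mor X Y) (u : mor X Z)
    (h : mor (T : C) X) : g ∘ f = u -> g ∘ (f ∘ h) = u ∘ h.
Proof. by move=> e; rewrite !mcompA e. Qed.

Lemma rea3 X Y Z W T (a : mor Z W) (b : mor Y Z) (c : mor X Y) (u : mor X W)
    (h : mor (T : C) X) : a ∘ (b ∘ c) = u -> a ∘ (b ∘ (c ∘ h)) = u ∘ h.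
Proof. by move=> e; rewrite -e !mcompA. Qed.

Lemma reaid X Y T (g : mor Y X) (f : mor X Y) (h : mor (T : C) X) :
  g ∘ f = idmor X -> g ∘ (f ∘ h) = h.
Proof. by move=> e; rewrite !mcompA e mcomp1m. Qed.

Variable m : monoidal C.
Local Notation "X ◁ f" := (tensm (m := m) (idmor X) f) : lincat_scope.

Lemma sl2 W X Y Y' Z (g : mor Y Z) (f : mor X Y) (g' : mor Y' Z) (f' : mor X Y') :
  g ∘ f = g' ∘ f' -> (W ◁ g) ∘ (W ◁ f) = (W ◁ g') ∘ (W ◁ f').
Proof. by move=> e; rewrite -!sl_comp e. Qed.

Lemma sl1 W X Y Z (g : mor Y Z) (f : mor X Y) (u : mor X Z) :
  g ∘ f = u -> (W ◁ g) ∘ (W ◁ f) = W ◁ u.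
Proof. by move=> e; rewrite -!sl_comp e. Qed.

Lemma slid W X Y (g : mor Y X) (f : mor X Y) :
  g ∘ f = idmor X -> (W ◁ g) ∘ (W ◁ f) = idmor (tens (m := m) W X).
Proof. by move=> e; rewrite -!sl_comp e tensm_id. Qed.

Lemma sl_merge W X Y Z T (g : mor Y Z) (f : mor X Y) (h : mor T _) :
  (W ◁ g) ∘ ((W ◁ f) ∘ h) = (W ◁ (g ∘ f)) ∘ h.
Proof. by rewrite sl_comp mcompA. Qed.

End Reassoc.

Arguments sl_merge {k C m} W {X Y Z T}.

Arguments sl2 {k C m} W {X Y Y' Z g f g' f'}.
Arguments sl1 {k C m} W {X Y Z g f u}.
Arguments slid {k C m} W {X Y g f}.

Section Ribbon.
Variables (k : fieldType) (C : lincat k) (m : monoidal C) (d : rigid m).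
Variables (s : braiding m) (th : twist d s).
Implicit Types X Y Z W A B P : C.
Local Notation I := (tunit m).
Local Notation "X ⊗ Y" := (tens (m := m) X Y) : lincat_scope.
Local Notation "f ⊗m g" := (tensm (m := m) f g) : lincat_scope.
Local Notation "X ◁ f" := (tensm (m := m) (idmor X) f) : lincat_scope.
Local Notation "f ▷ Z" := (tensm (m := m) f (idmor Z)) : lincat_scope.
Local Notation "X ^*" := (ldual d X) : lincat_scope.
Local Notation bz := (bz s).
Local Notation bzi := (bzi s).
Local Notation evz := (evz d).
Local Notation coz := (coz d).
Local Notation "'θ' X" := (theta th X) (at level 10, X at level 9).

(** * Transposes *)

Lemma ldualm_sr X Y (f : mor X Y) Z : ldualm d f ▷ Z =
  evz Y (X^* ⊗ Z) ∘ ((Y^* ◁ (f ▷ (X^* ⊗ Z))) ∘ (Y^* ◁ coz X Z)).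
Proof.
apply: pack_inj; rewrite /ldualm !sr_comp /runitV /lunit /assoc !eqm_sr.
by rewrite /evz /coz -!mcompA !packE -!/(pid _) -!ptens_id !ptensA.
Qed.

Lemma ldualm_evz X Y (f : mor X Y) Z :
  evz X Z ∘ (ldualm d f ▷ (X ⊗ Z)) = evz Y Z ∘ (Y^* ◁ (f ▷ Z)).
Proof.
rewrite ldualm_sr (rea _ (evz_nat _ _ _)); congr (_ ∘ _).
rewrite (rea _ (sl2 _ (slsr _ _))) (slid _ (zigzag _ _ _)).
by rewrite mcompm1.
Qed.

Lemma ldualm_coz X Y (f : mor X Y) Z :
  (f ▷ (X^* ⊗ Z)) ∘ coz X Z = (Y ◁ (ldualm d f ▷ Z)) ∘ coz Y Z.
Proof.
rewrite ldualm_sr !sl_comp -!mcompA coz_nat (rea _ (coz_nat _ _ _)).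
by rewrite (reaid _ (zigzag _ _ _)).
Qed.

Lemma sr_iso X Y (f : mor X Y) Z : is_iso f -> is_iso (f ▷ Z).
Proof.
case=> g [gf fg]; exists (g ▷ Z).
by split; rewrite -sr_comp ?gf ?fg tensm_id.
Qed.

(** * Twists *)

(** The double braiding of the unit with itself is trivial, so the twist of the unit is idempotent,
    and it is invertible. *)
Lemma theta_unit : θ I = idmor I.
Proof.
suff /(congr1 (fun f => invmor (θ I) ∘ f)) : θ I ∘ θ I = θ I.
  by have [vt _] := invmorP (theta_iso th I); rewrite mcompA vt mcomp1m.
apply: pack_inj; have : pack (θ (I ⊗ I)) = pack (θ I) by rewrite (tens1o m I).
move=> <-; rewrite theta_tens tensm_split; symmetry.
rewrite 2!pack_comp !pack_braid1.
rewrite -(pack_comp (idmor _)) mcomp1m -pack_comp mcomp1m.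
by rewrite !packE ptens1l ptens1r.
Qed.

Lemma theta_lift X Y Z : lift22 (θ (X ⊗ Y)) Z =
  bz Y X Z ∘ (bz X Y Z ∘ ((θ X ▷ (Y ⊗ Z)) ∘ (X ◁ (θ Y ▷ Z)))).
Proof.
by rewrite theta_tens tensm_split !lift22_comp lift22_sr lift22_sl -!mcompA.
Qed.

(** The twist of A (x) B passes through [e] by naturality and becomes the trivial twist of the
    unit. *)
Lemma theta_lift20 A B (e : mor (A ⊗ B) I) Z :
  lift20 e Z ∘ (bz B A Z ∘ (bz A B Z ∘ ((θ A ▷ (B ⊗ Z)) ∘ (A ◁ (θ B ▷ Z))))) =
  lift20 e Z.
Proof. by rewrite -theta_lift -lift20_comp -theta_nat theta_unit mcomp1m. Qed.

Lemma theta_lift02 A B (c : mor I (A ⊗ B)) Z :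
  bz B A Z ∘ (bz A B Z ∘ ((θ A ▷ (B ⊗ Z)) ∘ ((A ◁ (θ B ▷ Z)) ∘ lift02 c Z))) =
  lift02 c Z.
Proof.
have := lift02_comp (θ (A ⊗ B)) c Z.
by rewrite theta_nat theta_unit mcompm1 theta_lift -!mcompA => <-.
Qed.

Lemma theta_evz X Z :
  evz X Z ∘ (θ X^* ▷ (X ⊗ Z)) = evz X Z ∘ (X^* ◁ (θ X ▷ Z)).
Proof. by rewrite -theta_dual ldualm_evz. Qed.

(** * The pairing and copairing of X and its dual in the opposite order *)

(** The quantum evaluation: by [pivot_evz] it is the evaluation of the dual of X precomposed with
    the pivotal structure. *)
Definition evt_mor X : mor (X ⊗ X^*) I :=
  ev d X ∘ (braid s X X^* ∘ (θ X ▷ X^*)).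
Definition cot_mor X : mor I (X^* ⊗ X) :=
  braid s X X^* ∘ ((θ X ▷ X^*) ∘ coev d X).
Definition evt X Z : mor (X ⊗ (X^* ⊗ Z)) Z := lift20 (evt_mor X) Z.
Definition cot X Z : mor Z (X^* ⊗ (X ⊗ Z)) := lift02 (cot_mor X) Z.

Lemma evtE X Z : evt X Z = evz X Z ∘ (bz X X^* Z ∘ (θ X ▷ (X^* ⊗ Z))).
Proof. by rewrite /evt /evt_mor !(lift20_comp, lift22_comp) lift22_sr. Qed.

Lemma cotE X Z : cot X Z = bz X X^* Z ∘ ((θ X ▷ (X^* ⊗ Z)) ∘ coz X Z).
Proof. by rewrite /cot /cot_mor !lift02_comp lift22_sr. Qed.

Lemma cot_nat X Z Z' (g : mor Z Z') : (X^* ◁ (X ◁ g)) ∘ cot X Z = cot X Z' ∘ g.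
Proof. exact: lift02_nat. Qed.

(** After unfolding [evt], the left side is [ev] preceded by the whole twist of its source, which
    [ev] absorbs. *)
Lemma evt_theta X Z :
  evt X Z ∘ (bz X^* X Z ∘ (θ X^* ▷ (X ⊗ Z))) = evz X Z.
Proof.
rewrite evtE -!mcompA (rea _ (esym (bz_nat2 _ _ _ _))) slsr.
exact: theta_lift20.
Qed.

Lemma coz_theta X Z :
  bz X^* X Z ∘ ((θ X^* ▷ (X ⊗ Z)) ∘ cot X Z) = coz X Z.
Proof.
rewrite cotE (rea _ (esym (bz_nat2 _ _ _ _))) (rea _ (slsr _ _)).
exact: theta_lift02.
Qed.

(* theta_dual moves the second twist of evt_theta to the other strand. *)
Lemma evt_theta' X Z : evt X Z ∘ ((θ X ▷ (X^* ⊗ Z)) ∘ bz X^* X Z) = evz X Z.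
Proof.
have D : evz X Z ∘ (bz X X^* Z ∘ (bz X^* X Z ∘ (X^* ◁ (θ X ▷ Z)))) =
    evz X Z ∘ (bz X X^* Z ∘ (bz X^* X Z ∘ (θ X^* ▷ (X ⊗ Z)))).
  rewrite bz_nat1 (rea _ (bz_nat2 _ _ _ _)) (rea _ (theta_evz _ _)).
  by rewrite bz_nat2 (rea _ (bz_nat1 _ _ _ _)).
rewrite -[RHS]evt_theta evtE -!mcompA !(rea _ (esym (bz_nat2 _ _ _ _))) slsr.
rewrite -bz_nat2 (rea _ (esym (bz_nat2 _ _ _ _))).
by rewrite !mcompA; congr (_ ∘ _); rewrite -!mcompA D.
Qed.

(** Sliding the spectator dual strand across both the copairing and the pairing leaves [evt] after a
    crossing and a twist; [evt_theta'] makes this [evz], and the ordinary zigzag remains. *)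
Lemma evt_zigzag X Z : (X^* ◁ evt X Z) ∘ cot X (X^* ⊗ Z) = idmor (X^* ⊗ Z).
Proof.
pose e Z := lift20 (evt_mor X ∘ (θ X ▷ X^*)) Z.
have eE Z' : e Z' = evt X Z' ∘ (θ X ▷ (X^* ⊗ Z')).
  by rewrite /e lift20_comp lift22_sr.
rewrite cotE (rea _ (bz_nat1 _ _ _ _)) (rea1 _ (sl1 _ (esym (eE _)))).
rewrite -[coz X _](slide02 s X^* (coev d X) Z) /b2 -/(coz X Z).
have := slide20' s X^* (evt_mor X ∘ (θ X ▷ X^*)) Z.
rewrite /b2' -/(e Z) -/(e _) => H.
rewrite !mcompA -(mcompA _ (bz X X^* _)) -H eE -(mcompA (evt X _)) evt_theta'.
exact: zagzig.
Qed.

Lemma evt_transpose X Y (f : mor X Y) Z :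
  evt Y Z ∘ (f ▷ (Y^* ⊗ Z)) = evt X Z ∘ (X ◁ (ldualm d f ▷ Z)).
Proof.
rewrite !evtE -!mcompA -sr_comp theta_nat sr_comp (rea _ (bz_nat1 _ _ _ _)).
rewrite (rea _ (esym (ldualm_evz _ _))) -slsr (rea _ (bz_nat2 _ _ _ _)).
by [].
Qed.

Lemma evz_slide W X Z :
  evz X (W ⊗ Z) ∘ ((X^* ◁ bz W X Z) ∘ bz W X^* (X ⊗ Z)) = W ◁ evz X Z.
Proof. by have := slide20 s W (ev d X) Z; rewrite /b2 => ->. Qed.

Lemma evt_slide W X Z :
  (W ◁ evt X Z) ∘ (bz X W (X^* ⊗ Z) ∘ (X ◁ bz X^* W Z)) = evt X (W ⊗ Z).
Proof. by have := slide20' s W (evt_mor X) Z; rewrite /b2' => <-. Qed.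

Lemma coz_slide W X Z :
  bz X W (X^* ⊗ Z) ∘ ((X ◁ bz X^* W Z) ∘ coz X (W ⊗ Z)) = W ◁ coz X Z.
Proof. by have := slide02' s W (coev d X) Z; rewrite /b2' -mcompA => <-. Qed.

(** Precomposition with the invertible K turns [evt] into [evz], for which nesting is part of strict
    duality. It remains to see that the nested [evt] behaves in the same way. *)
Lemma evt_tens P X Z :
  evt (P ⊗ X) Z ∘ eqm (tens2_cast d P X Z) = evt P Z ∘ (P ◁ evt X (P^* ⊗ Z)).
Proof.
pose A := P ⊗ X.
pose K := bz A^* A Z ∘ (θ A^* ▷ (A ⊗ Z)).
pose U := P ⊗ (X ⊗ Z).
(* K in elementary crossings: the hexagons split the braiding, and [theta_lift] splits the twist of
   the tensor product of the duals. *)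
pose K' := b2 s X^* P X (P^* ⊗ Z) ∘ ((X^* ◁ b2 s P^* P X Z) ∘
  (bz P^* X^* U ∘ (bz X^* P^* U ∘ ((θ X^* ▷ (P^* ⊗ U)) ∘ (X^* ◁ (θ P^* ▷ U)))))).
have KE : K ∘ eqm (tens2_castV d P X Z) = eqm (tens2_cast d P X Z) ∘ K'.
  apply: pack_inj; rewrite pack_eqmr pack_eqml.
  have -> : pack K = pack (bz (X^* ⊗ P^*) A Z ∘ (θ (X^* ⊗ P^*) ▷ (A ⊗ Z))).
    by rewrite /K /A ldual_tens.
  rewrite /K' -theta_lift (mcompA (b2 _ _ _ _ _)) [LHS]pack_comp [RHS]pack_comp.
  congr (pkcomp _ _).
    rewrite /bz pack_lift22 -pack_b2' /b2' [LHS]pack_comp [RHS]pack_comp.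
    by rewrite !pack_tens !pack_b2 /bz !pack_lift22.
  by rewrite pack_lift22 pack_tens /A /U -!/(pid _) -!ptens_id !ptensA.
have K'E : evt P Z ∘ ((P ◁ evt X (P^* ⊗ Z)) ∘ K') =
    evz X Z ∘ (X^* ◁ evz P (X ⊗ Z)).
  rewrite /K' /b2 !sl_comp -!mcompA.
  rewrite (rea _ (bz_nat1 _ _ _ _)) (rea _ (bz_nat2 _ _ _ _)).
  rewrite (rea _ (slsr _ _)) (rea _ (slsr _ _)) (rea _ (bz_nat1 _ _ _ _)).
  rewrite 2!(sl_merge P) -mcompA evt_theta.
  rewrite (rea _ (bz_nat3 _ _ _ _)).
  (* Yang-Baxter moves the crossing of the two dual strands past P, so that the evaluation of X
     absorbs it by [evz_slide]. *)
  have YB := bz_yang_baxter s P^* X^* P (X ⊗ Z); rewrite /b2' -!mcompA in YB.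
  rewrite -/U in YB. 
  rewrite (rea3 _ (esym YB)) -!mcompA 2!(sl_merge P) -(mcompA (evz _ _)) evz_slide.
  rewrite (rea _ (esym (bz_nat3 _ _ _ _))) bz_nat2 (rea _ (slsr _ _)).
  rewrite (rea _ (slsr _ _)) (rea3 _ (evt_theta _ _)) (rea _ (esym (evz_nat _ _ _))).
  by rewrite evz_slide.
have epK' : epi K'.
  have -> : K' = eqm (esym (tens2_cast d P X Z)) ∘ (K ∘ eqm (tens2_castV d P X Z)).
    by rewrite KE mcompA eqmK mcomp1m.
  apply: epi_comp; first by apply: iso_epi; exact: eqm_iso.
  apply: epi_comp; last by apply: iso_epi; exact: eqm_iso.
  apply: epi_comp; first by apply: iso_epi; exact: bz_iso.
  by apply: iso_epi; apply: sr_iso; exact: theta_iso.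
apply: epK'; rewrite -!mcompA K'E -KE -evz_tens -evt_theta -/A /K.
by rewrite -!mcompA.
Qed.

End Ribbon.

(** * Projective objects and tensor products *)

Section TensorProjective.
Variables (k : fieldType) (C : lincat k) (m : monoidal C) (d : rigid m).
Variable s : braiding m.
Implicit Types X Y Z W P : C.
Local Notation I := (tunit m).
Local Notation "X ⊗ Y" := (tens (m := m) X Y) : lincat_scope.
Local Notation "X ◁ f" := (tensm (m := m) (idmor X) f) : lincat_scope.
Local Notation "f ▷ Z" := (tensm (m := m) f (idmor Z)) : lincat_scope.
Local Notation evrz := (evrz d).
Local Notation corz := (corz d).

(** Tensoring with W on the left is left adjoint to tensoring with its right dual, and [transK]
    recovers a morphism from its adjunct. *)
Lemma sl_epi W Y Z (e : mor Y Z) : epi e -> epi (W ◁ e).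
Proof.
move=> ee T g h gh.
have transK (u : mor (W ⊗ Z) T) : u = evrz W T ∘ (W ◁ ((rdual d W ◁ u) ∘ corz W Z)).
  rewrite sl_comp mcompA -[X in X ∘ _](lift20_nat (evr d W)) -mcompA.
  by rewrite rzigzag mcompm1.
rewrite (transK g) (transK h); congr (_ ∘ (W ◁ _)); apply: ee.
rewrite -!mcompA -[corz W Z ∘ e](lift02_nat (coevr d W)) !mcompA.
by rewrite -!(sl_comp (rdual d W)) gh.
Qed.

Lemma sr_epi W Y Z (e : mor Y Z) : epi e -> epi (e ▷ W).
Proof.
move=> /(sl_epi (W := W)) ee T g h gh.
have bi := braid_iso s W Z; apply: (iso_epi bi); apply: ee.
by rewrite -!mcompA braid_nat !mcompA gh.
Qed.

(** The right adjoint of tensoring with X preserves epimorphisms by [sl_epi], so the left adjoint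
    preserves projectives. *)
Lemma projective_tensl X P : projective P -> projective (X ⊗ P).
Proof.
move=> pP Y Z e f ee.
have [g gE] := pP _ _ _ ((rdual d X ◁ f) ∘ corz X P) (sl_epi (W := rdual d X) ee).
exists (evrz X Y ∘ (X ◁ g)).
rewrite mcompA (lift20_nat (evr d X)) -mcompA -sl_comp gE sl_comp mcompA.
by rewrite -[X in X ∘ _](lift20_nat (evr d X)) -mcompA rzigzag mcompm1.
Qed.

Lemma projective_tensr P X : projective P -> projective (P ⊗ X).
Proof.
move=> /(projective_tensl (X := X)); have [vb _] := invmorP (braid_iso s P X).
exact: projective_retract vb.
Qed.

(** A zigzag identity exhibits the dual of P as a retract of a tensor product having P as a
    factor. *)
Lemma projective_ldual P : projective P -> projective (ldual d P).
Proof.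
move=> pP; have H := ldual_zagzig d P; rewrite -mcompA in H.
apply: projective_retract H _.
by apply: projective_tensl; apply: projective_tensr.
Qed.

End TensorProjective.

(** * The pivotal structure *)

Section Pivotal.
Variables (k : fieldType) (C : ribbon_ftc k).
Local Notation m := (rmon C).
Local Notation d := (rrig C).
Implicit Types X Y Z P Q : C.
Local Notation I := (tunit m).
Local Notation "X ⊗ Y" := (tens (m := m) X Y) : lincat_scope.
Local Notation "f ⊗m g" := (tensm (m := m) f g) : lincat_scope.
Local Notation "X ◁ f" := (tensm (m := m) (idmor X) f) : lincat_scope.
Local Notation "f ▷ Z" := (tensm (m := m) f (idmor Z)) : lincat_scope.
Local Notation "X ^*" := (ldual d X) : lincat_scope.
Local Notation bz := (bz (rbraid C)).
Local Notation bzi := (bzi (rbraid C)).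
Local Notation evz := (evz d).
Local Notation coz := (coz d).
Local Notation evt := (evt (rtwist C)).
Local Notation cot := (cot (rtwist C)).
Local Notation "'θ' X" := (theta (rtwist C) X) (at level 10, X at level 9).

Lemma pivot_sr X Z : pivot X ▷ Z =
  evz X ((X^*)^* ⊗ Z) ∘
    (bz X X^* ((X^*)^* ⊗ Z) ∘ ((X ◁ coz X^* Z) ∘ (θ X ▷ Z))).
Proof.
apply: pack_inj; rewrite /pivot /drinfeld -!mcompA !sr_comp.
rewrite /runitV /lunit /assoc !eqm_sr /evz /coz /bz !packE -!/(pid _).
by rewrite -!ptens_id !ptensA.
Qed.

Lemma pivot_evz X Z : evz X^* Z ∘ (pivot X ▷ (X^* ⊗ Z)) = evt X Z.
Proof.
rewrite pivot_sr (rea _ (evz_nat _ _ _)) (rea _ (esym (bz_nat3 _ _ _ _))).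
by rewrite (reaid _ (slid _ (zigzag _ _ _))) evtE.
Qed.

(** By [pivot_evz] the pivot is detected by [evt], which is [ev] up to an invertible crossing and
    twist, and [ev] is nondegenerate. *)
Lemma pivot_mono X : mono (pivot X).
Proof.
move=> T a b ab.
have {}ab Z : evt X Z ∘ (a ▷ (X^* ⊗ Z)) = evt X Z ∘ (b ▷ (X^* ⊗ Z)).
  by rewrite -!pivot_evz -!mcompA -!sr_comp ab.
have {}ab Z : evz X Z ∘ (X^* ◁ ((θ X ∘ a) ▷ Z)) = evz X Z ∘ (X^* ◁ ((θ X ∘ b) ▷ Z)).
  apply: (iso_epi (bz_iso (rbraid C) T X^* Z)); rewrite -!mcompA -!bz_nat1.
  have E c : evz X Z ∘ (bz X X^* Z ∘ ((θ X ∘ c) ▷ (X^* ⊗ Z))) =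
      evt X Z ∘ (c ▷ (X^* ⊗ Z)).
    by rewrite sr_comp evtE -!mcompA.
  by rewrite !E ab.
apply: (iso_mono (theta_iso (rtwist C) X)); apply: (@sr_inj _ _ m).
rewrite -[LHS]mcomp1m -[RHS]mcomp1m -(zigzag d X I) -!mcompA.
by rewrite -!coz_nat !(sl_merge X) ab.
Qed.

Lemma pivot_cot X Z : (X^* ◁ (pivot X ▷ Z)) ∘ cot X Z = coz X^* Z.
Proof.
apply: (@copairing_unique _ _ _ _ _ _ (fun Z => (X^* ◁ (pivot X ▷ Z)) ∘ cot X Z)).
  move=> W W' g; by rewrite -mcompA -cot_nat !(sl_merge X^*) slsr.
move=> W; rewrite (sl_merge X^*) pivot_evz; exact: evt_zigzag.
Qed.

(** [q] is the mate of [cot]; it is a right inverse by [pivot_cot], and a monomorphism with a right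
    inverse is invertible. *)
Lemma pivot_iso X : is_iso (pivot X).
Proof.
pose q := runit X ∘ ((evz X^* (X ⊗ I) ∘ ((X^*)^* ◁ cot X I)) ∘ runitV ((X^*)^*)).
have pq : pivot X ∘ q = idmor ((X^*)^*).
  have H : (pivot X ▷ I) ∘ (evz X^* (X ⊗ I) ∘ ((X^*)^* ◁ cot X I)) = idmor _.
    rewrite (rea _ (evz_nat _ _ _)) -sl_comp pivot_cot; exact: zagzig.
  by rewrite /q (rea _ (esym (tensm1 m (pivot X)))) (rea1 _ H) mcomp1m eqmK.
exists q; split=> //; apply: pivot_mono.
by rewrite mcompA pq mcomp1m mcompm1.
Qed.

Lemma pivotVK X : invmor (pivot X) ∘ pivot X = idmor X.
Proof. by have [] := invmorP (pivot_iso X). Qed.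

Lemma pivotKV X : pivot X ∘ invmor (pivot X) = idmor ((X^*)^*).
Proof. by have [] := invmorP (pivot_iso X). Qed.

(** * Partial traces *)

Lemma right_ptrace_sr P X (f : mor (P ⊗ X) (P ⊗ (X^*)^*)) Z :
  right_ptrace f ▷ Z =
  (P ◁ evz X^* Z) ∘ (lift22 f (X^* ⊗ Z) ∘ (P ◁ coz X Z)).
Proof.
apply: pack_inj; rewrite /right_ptrace -!mcompA !sr_comp.
rewrite /runitV /runit /assoc /assocV !eqm_sr /evz /coz !packE -!/(pid _).
by rewrite -!ptens_id !ptensA.
Qed.

Lemma right_ptrace_pivot P X (f : mor (P ⊗ X) (P ⊗ X)) Z :
  right_ptrace ((P ◁ pivot X) ∘ f) ▷ Z =
  (P ◁ evt X Z) ∘ (lift22 f (X^* ⊗ Z) ∘ (P ◁ coz X Z)).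
Proof.
rewrite right_ptrace_sr lift22_comp lift22_sl -mcompA (sl_merge P).
by rewrite pivot_evz.
Qed.

(** Since the two dualities are mutually inverse, [evr] and [coevr] become [ev] and [coev] of Y and
    of its dual. *)
Lemma left_ptrace_sr P X (f : mor (X ⊗ P) (rdual d (rdual d X) ⊗ P)) Z
    (Y := rdual d (rdual d X)) :
  left_ptrace f ▷ Z =
  evz Y (P ⊗ Z) ∘ ((Y^* ◁ lift22 (f ∘ (eqm (rdual2K d X) ▷ P)) Z) ∘
    coz Y^* (P ⊗ Z)).
Proof.
have evrE : pack (evr d (rdual d X)) = pack (ev d Y).
  have -> : pack (evr d (rdual d X)) = pack (evr d Y^*).
    by rewrite /Y (rdualK d (rdual d X)).
  by rewrite evr_ldual eqm_sl pack_eqmr.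
have coevrE : pack (coevr d X) = pack (coev d Y^*).
  rewrite coevr_ldual eqm_sr pack_eqml.
  have -> : X = ldual d Y^* by rewrite /Y rdual2K.
  by [].
apply: pack_inj; rewrite /left_ptrace -!mcompA !sr_comp.
rewrite /lunitV /lunit /assoc /assocV !eqm_sr /evz /coz.
rewrite !packE evrE coevrE -!/(pid _) -!ptens_id !ptensA.
by have -> : pid (rdual d X) = pid Y^* by rewrite /Y (rdualK d (rdual d X)).
Qed.

(* The loop of X around f, closed on the right after conjugation by the
   braiding with P, is pulled over P to the left. *)
Lemma ptrace_rotate P X (f : mor (X ⊗ P) (X ⊗ P)) Z
    (b := braid (rbraid C) X P) :
  (P ◁ evt X Z) ∘ (lift22 (b ∘ f ∘ invmor b) (X^* ⊗ Z) ∘ (P ◁ coz X Z)) =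
  evz X (P ⊗ Z) ∘ ((X^* ◁ lift22 f Z) ∘ cot X (P ⊗ Z)).
Proof.
rewrite !lift22_comp -[lift22 b _]/(bz X P (X^* ⊗ Z)).
rewrite -[lift22 (invmor b) _]/(bzi X P (X^* ⊗ Z)) -!mcompA.
rewrite -(coz_slide d (rbraid C)) (reaid _ (bzK _ _ _ _)).
rewrite -(coz_theta (rtwist C)).
have sf := slide22 (rbraid C) X^* f Z; rewrite /b2 -!mcompA in sf.
have := esym (congr1 (fun u => u ∘ ((θ X^* ▷ _) ∘ cot X (P ⊗ Z))) sf).
rewrite -!mcompA => ->.
rewrite (rea3 _ (evt_slide _ _ _ _)) (rea _ (slsr _ _)).
by rewrite (rea3 _ (evt_theta _ _ _)).
Qed.

(** * The trace defined by a pairing on projective objects *)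

Section TraceOfPairing.
Variable kap : forall P : C, 'Hom(mor P I, 'Hom(mor I P, k^o)).
Hypothesis kap_nat : forall P Q (f : mor P Q) y,
  projective P -> projective Q -> kap P (y ∘ f) = mor_transpose I f (kap Q y).

Lemma kapE P Q (f : mor P Q) x y :
  projective P -> projective Q -> kap Q y (f ∘ x) = kap P (y ∘ f) x.
Proof. by move=> pP pQ; rewrite kap_nat // mor_transposeE. Qed.

Definition ptr P : 'Hom(mor P P, k^o) := linfun (fun f : mor P P =>
  kap (P ⊗ (P^* ⊗ I)) (evt P I) ((f ▷ (P^* ⊗ I)) ∘ coz P I)).

Lemma ptrE P f :
  ptr P f = kap (P ⊗ (P^* ⊗ I)) (evt P I) ((f ▷ (P^* ⊗ I)) ∘ coz P I).
Proof.
by apply: linfunE => a u v; rewrite tensm_linearl mcomp_linearl linearP.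
Qed.

(** [f] travels around the loop: through the copairing it becomes its transpose, naturality of [kap]
    brings this to the quantum evaluation, and there it becomes [f] again. *)
Lemma ptr_cyclic P Q (f : mor P Q) (g : mor Q P) :
  projective P -> projective Q -> ptr P (g ∘ f) = ptr Q (f ∘ g).
Proof.
move=> pP pQ; rewrite !ptrE !sr_comp -!mcompA (ldualm_coz d f).
rewrite (rea _ (esym (slsr _ _))).
have pr := projective_tensr d (rbraid C).
by rewrite kapE -?evt_transpose; [rewrite [RHS]kapE //; exact: pr | exact: pr..].
Qed.

(** The copairing and quantum evaluation of P (x) X are nested; naturality of [kap] moves the inner
    ones next to [f], where they form the partial trace. *)
Lemma ptr_right P X (f : mor (P ⊗ X) (P ⊗ (X^*)^*)) : projective P ->
  ptr P (right_ptrace f) = ptr (P ⊗ X) ((P ◁ invmor (pivot X)) ∘ f).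
Proof.
move=> pP; set f' := _ ∘ f.
have -> : f = (P ◁ pivot X) ∘ f'.
  by rewrite /f' mcompA -sl_comp pivotKV tensm_id mcomp1m.
have pr := projective_tensr d (rbraid C).
have pPX := pr _ X pP.
rewrite !ptrE coz_tens.
have cast : (f' ▷ ((P ⊗ X)^* ⊗ I)) ∘ eqm (tens2_cast d P X I) =
    eqm (tens2_cast d P X I) ∘ lift22 f' (X^* ⊗ (P^* ⊗ I)).
  apply: pack_inj; rewrite pack_eqml pack_eqmr pack_lift22 pack_tens.
  by rewrite ldual_tens -!/(pid _) -!ptens_id !ptensA.
rewrite (rea _ cast) [RHS]kapE; try exact: pr.
rewrite evt_tens -[RHS]kapE; try exact: pr.
by rewrite right_ptrace_pivot -!mcompA.
Qed.

Lemma ptr_left P X (f : mor (X ⊗ P) (rdual d (rdual d X) ⊗ P)) : projective P ->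
  ptr P (left_ptrace f) =
  ptr (X ⊗ P) (((eqm (rdual2K d X) ∘ pivot (rdual d (rdual d X))) ⊗m idmor P) ∘ f).
Proof.
move=> pP; set Y := rdual d (rdual d X).
have pl W : projective (W ⊗ P) by apply: (projective_tensl d).
have pr W : projective (P ⊗ W) by exact: projective_tensr d (rbraid C) _ _ pP.
(* Cyclicity replaces the endomorphism of X (x) P by one of Y (x) P. *)
rewrite [RHS]ptr_cyclic //; set F := f ∘ _.
pose b := braid (rbraid C) Y P.
have [vb bv] := invmorP (braid_iso (rbraid C) Y P).
(* Conjugating with the braiding, again by cyclicity, brings Y to the right of P, where [ptr_right]
   applies. *)
rewrite -[F]mcomp1m -vb -mcompA [RHS]ptr_cyclic // -/b.
rewrite -[b ∘ F ∘ _]mcomp1m -tensm_id -(pivotVK Y) sl_comp -mcompA -ptr_right //.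
congr (ptr P _); apply: (@sr_inj _ _ m); rewrite right_ptrace_pivot ptrace_rotate.
rewrite left_ptrace_sr -pivot_cot; congr (_ ∘ _); rewrite (sl_merge Y^*).
congr ((_ ◁ _) ∘ _).
by rewrite /F sr_comp mcompA [RHS]lift22_comp lift22_sr.
Qed.

End TraceOfPairing.

End Pivotal.

(** * Modified traces and unimodularity *)

Section Dimension.
Variable k : fieldType.

Lemma dim_inj (V W : vectType k) (f : 'Hom(V, W)) :
  injective f -> (\dim {:V} <= \dim {:W})%N.
Proof.
move=> /lker0P/eqP f0; rewrite -(@limg_dim_eq _ _ _ f fullv) ?dimvS ?subvf //.
by rewrite f0 capv0.
Qed.

Lemma dim_dual (V : vectType k) : \dim {:'Hom(V, k^o)} = \dim {:V}.
Proof. by rewrite !dimvf; exact: muln1. Qed.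

Lemma inj_dim_bij (V W : vectType k) (f : 'Hom(V, W)) :
  injective f -> \dim {:V} = \dim {:W} -> bijective f.
Proof.
move=> f_inj VW; have f0 : lker f == 0%VS by apply/lker0P.
have ff : limg f = fullv.
  apply/eqP; rewrite eqEdim subvf /= -VW limg_dim_eq //.
  by rewrite (eqP f0) capv0.
exists (f^-1)%VF; first exact: lker0_lfunK.
by move=> w; rewrite limg_lfunVK // ff memvf.
Qed.

End Dimension.

Section ScalarOfLfun.
Variables (k : fieldType) (V : vectType k) (u : 'Hom(V, k^o)).

Fact scalar_of_lfun_subproof : scalar (fun x => u x : k).
Proof. by move=> a x y; rewrite linearP. Qed.

Definition scalar_of_lfun : {scalar V} :=
  HB.pack (fun x => u x : k)
    (GRing.isLinear.Build k V k *%R (fun x => u x : k) scalar_of_lfun_subproof).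

End ScalarOfLfun.

Section Unimodularity.
Variables (k : fieldType) (C : ribbon_ftc k).
Local Notation m := (rmon C).
Local Notation d := (rrig C).
Implicit Types X Y Z P Q : C.
Local Notation I := (tunit m).
Local Notation "X ⊗ Y" := (tens (m := m) X Y) : lincat_scope.
Local Notation "f ⊗m g" := (tensm (m := m) f g) : lincat_scope.
Local Notation "X ◁ f" := (tensm (m := m) (idmor X) f) : lincat_scope.
Local Notation "f ▷ Z" := (tensm (m := m) f (idmor Z)) : lincat_scope.
Local Notation "X ^*" := (ldual d X) : lincat_scope.
Local Notation evz := (evz d).
Local Notation coz := (coz d).
Local Notation evt := (evt (rtwist C)).
Local Notation pres := (finite_presentations (rfinite C)).

Lemma sl0 X Y Z : X ◁ (0 : mor Y Z) = 0.
Proof.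
have := @tensm_linearr _ _ m _ _ _ _ (idmor X) (-1) (0 : mor Y Z) 0.
by rewrite scaler0 addr0 scaleN1r addNr.
Qed.

Lemma sr0 X Y Z : (0 : mor Y Z) ▷ X = 0.
Proof.
have := @tensm_linearl _ _ m _ _ _ _ (idmor X) (-1) (0 : mor Y Z) 0.
by rewrite scaler0 addr0 scaleN1r addNr.
Qed.

(** The endomorphism is the mate of the point, obtained by evaluating its dual strand against P. *)
Lemma endo_of_point P (x : mor I (P ⊗ (P^* ⊗ I))) :
  exists f : mor P P, (f ▷ (P^* ⊗ I)) ∘ coz P I = x.
Proof.
have [x0 <-] : exists x0, lift02 x0 I = x.
  exists ((P ◁ runit P^*) ∘ x); apply: pack_inj.
  by rewrite pack_lift02 ptens1r /runit eqm_sl pack_eqml.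
pose f := runit P ∘ ((P ◁ ev d P) ∘ (assocV P P^* P ∘ ((x0 ▷ P) ∘ lunitV P))).
have fE Z : f ▷ Z = (P ◁ evz P Z) ∘ lift02 x0 (P ⊗ Z).
  apply: pack_inj; rewrite /f !sr_comp /lunitV /runit /assocV !eqm_sr /evz !packE.
  by rewrite -!/(pid _) -!ptens_id !ptensA.
exists f; rewrite fE -mcompA -lift02_nat (sl_merge P) zagzig tensm_id.
by rewrite mcomp1m.
Qed.

Lemma unit_neq0 : idmor I <> 0.
Proof. by case: (runit_simple C). Qed.

Lemma epi_unit_neq0 P (e : mor P I) : epi e -> e <> 0.
Proof. by move=> ee e0; apply: unit_neq0; apply: ee; rewrite e0 !mcomp0. Qed.

(** If [evt] vanished, then so would [evz], hence the identity of P by the zigzag, and [e] with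
    it. *)
Lemma evt_neq0 P (e : mor P I) : epi e -> evt P I <> 0.
Proof.
move=> /epi_unit_neq0 e0 v0; apply: e0.
suff id0 : idmor P = 0 by rewrite -[e]mcompm1 id0 mcomp0.
apply: (@sr_inj _ _ m); rewrite tensm_id -(zigzag d) -(evt_theta (rtwist C)) v0.
by rewrite mcomp0m sl0 mcomp0m sr0.
Qed.

Lemma trace_of_unimodular : unimodular C ->
  exists t : forall P : C, {scalar (mor P P)},
    modified_trace t /\ nonzero_on_proj t.
Proof.
case=> alpha [/is_nakayamaP-/(_ (finite_copowers (rfinite C)))[i [nat_i univ_i]]].
case=> phi [psi [psiphi phipsi]].
have bij_i := universal_proj_bij (rfinite C) nat_i univ_i.
(* Transporting the universal family along the isomorphism from alpha to the unit gives values in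
   Hom(X, 1); on projectives the inverse [kap] is the pairing. *)
pose j X : 'Hom('Hom(mor I X, k^o), mor X I) := (lcomp X phi \o i X)%VF.
have jE X xi : j X xi = phi ∘ i X xi by rewrite /j comp_lfunE lcompE.
have bij_j P : projective P -> bijective (j P).
  move=> /bij_i[i' iK Ki]; exists (fun y => i' (psi ∘ y)) => [xi|y].
    by rewrite jE mcompA psiphi mcomp1m iK.
  by rewrite jE Ki mcompA phipsi mcomp1m.
pose kap P : 'Hom(mor P I, 'Hom(mor I P, k^o)) := (j P)^-1%VF.
have jK P : projective P -> cancel (j P) (kap P).
  by move=> /bij_j/bij_inj ji; apply: lker0_lfunK; apply/lker0P.
have kapK P : projective P -> cancel (kap P) (j P).
  by move=> pP y; have [g gK Kg] := bij_j P pP; rewrite -[y]Kg jK.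
have kap_nat P Q (f : mor P Q) y : projective P -> projective Q ->
    kap P (y ∘ f) = mor_transpose I f (kap Q y).
  move=> pP pQ; rewrite -{1}(kapK Q pQ y) jE -mcompA -nat_i -jE.
  by rewrite jK.
exists (fun P => scalar_of_lfun (ptr kap P)); split.
  split=> *; [exact: ptr_cyclic|exact: ptr_right|exact: ptr_left].
(* A projective object with an epimorphism to the unit carries an endomorphism of nonzero trace. *)
have [P [_ [e [_ [pP _ ee _ _]]]]] := pres I.
exists P; split=> //.
have pW : projective (P ⊗ (P^* ⊗ I)) by exact: projective_tensr d (rbraid C) _ _ pP.
have : kap _ (evt P I) <> 0.
  by move=> v0; apply: (evt_neq0 ee); rewrite -(kapK _ pW (evt P I)) v0 linear0.
have [//|/eqP/lfunPn[x xn0]] := pselect (kap _ (evt P I) = 0).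
have [f fx] := endo_of_point x.
by exists f; rewrite [X in X <> _]ptrE fx; apply/eqP; rewrite zero_lfunE in xn0.
Qed.

(** Duality embeds Hom(1, P) by the zigzag identity; the extra units are those that the spectator
    calculus produces. *)
Lemma dim_points P : (\dim {:mor I P} <= \dim {:mor (P^* ⊗ (I ⊗ I)) I})%N.
Proof.
pose g (x : mor I P) := evz P I ∘ (P^* ◁ (x ▷ I)).
have gL : linear g.
  by move=> a u v; rewrite /g tensm_linearl tensm_linearr mcomp_linearr.
apply: (dim_inj (f := linfun g)) => x y; rewrite !linfunE // => xy.
apply: (@sr_inj _ _ m); rewrite -[LHS]mcomp1m -[RHS]mcomp1m -(zigzag d P I) -!mcompA.
by rewrite -!coz_nat !(sl_merge P) -!/(g _) xy.
Qed.

Lemma dim_copoints P W : (\dim {:mor I (P^* ⊗ W)} <= \dim {:mor (P ⊗ I) W})%N.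
Proof.
pose g (z : mor I (P^* ⊗ W)) := evt P W ∘ (P ◁ z).
have gL : linear g by move=> a u v; rewrite /g tensm_linearr mcomp_linearr.
apply: (dim_inj (f := linfun g)) => x y; rewrite !linfunE // => xy.
rewrite -[x]mcomp1m -[y]mcomp1m -(evt_zigzag (rtwist C) P W) -!mcompA.
by rewrite -!cot_nat !(sl_merge P^*) -!/(g _) xy.
Qed.

Section PairingOfTrace.
Variable t : forall P : C, {scalar (mor P P)}.
Hypotheses (mt : modified_trace t) (nzt : nonzero_on_proj t).

(** The image of [y] is a nonzero subobject of the simple unit. *)
Lemma nonzero_unit_epi P (y : mor P I) : y <> 0 -> epi y.
Proof.
move=> y0; have [J [p [i [ep mi ip]]]] := finite_images (rfinite C) y.
have [_ /(_ _ i mi)[i0|iso_i]] := runit_simple C.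
  by case: y0; rewrite -ip i0 mcomp0m.
by rewrite -ip; apply: epi_comp => //; exact: iso_epi.
Qed.

Definition pairing P : 'Hom(mor P I, 'Hom(mor I P, k^o)) :=
  linfun (fun y : mor P I => linfun (fun x : mor I P => t P (x ∘ y) : k^o)).

Lemma pairingE P y x : pairing P y x = t P (x ∘ y).
Proof.
have E (y' : mor P I) : linfun (fun x : mor I P => t P (x ∘ y') : k^o) =1
    fun x => t P (x ∘ y').
  by apply: linfunE => a u v; rewrite mcomp_linearl linearP.
rewrite /pairing linfunE ?E // => a u v; apply/lfunP => w.
by rewrite add_lfunE scale_lfunE !E mcomp_linearr linearP.
Qed.

Lemma pairing_nat P Q (f : mor P Q) y : projective P -> projective Q ->
  pairing P (y ∘ f) = mor_transpose I f (pairing Q y).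
Proof.
move=> pP pQ; apply/lfunP => x; rewrite mor_transposeE !pairingE.
by rewrite mcompA (mtr_cyclic mt) // mcompA.
Qed.

(** [y] does not meet the strand that is closed up, so it slides out to the bottom. *)
Lemma right_ptrace_factor P Z (y : mor P I) (F : mor Z (P ⊗ (Z^*)^*)) :
  exists x, right_ptrace (F ∘ (lunit Z ∘ (y ▷ Z))) = x ∘ y.
Proof.
pose u := runit P ∘ ((P ◁ ev d Z^*) ∘ (assocV P (Z^*)^* Z^* ∘ (((F ∘ lunit Z) ▷ Z^*)
  ∘ (assoc I Z Z^* ∘ ((I ◁ coev d Z) ∘ runitV I))))).
exists u; rewrite /right_ptrace /u -!mcompA; do 3!congr (_ ∘ _).
rewrite (mcompA F) !sr_comp -!mcompA; do 2!congr (_ ∘ _).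
apply: pack_inj.
transitivity (pack ((I ◁ coev d Z) ∘ (y ▷ I))); last first.
  rewrite [RHS]pack_eqml [RHS]pack_comp [LHS]pack_comp; congr (pkcomp _ _).
  by rewrite [RHS]pack_eqml pack_tens ptens1r.
rewrite slsr !mcompA [LHS]pack_eqmr [LHS]pack_comp [RHS]pack_comp.
congr (pkcomp _ _); rewrite pack_eqmr !pack_tens.
by rewrite -!/(pid _) -ptens_id ptensA.
Qed.

Lemma pairing_inj P : projective P -> injective (pairing P).
Proof.
move=> pP; apply/lker0P/eqP; apply/vspaceP => y; rewrite memv_ker memv0.
apply/eqP/eqP => [y0|->]; last by rewrite linear0.
apply: contrapT => /nonzero_unit_epi ey.
have [Z [pZ [f]]] := nzt; apply.
pose y' := lunit Z ∘ (y ▷ Z).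
have ey' : epi y'.
  apply: epi_comp; first by apply: iso_epi; exact: eqm_iso.
  exact: (sr_epi d (rbraid C)).
have [g gE] := pZ _ _ y' f ey'.
have pPZ : projective (P ⊗ Z) by exact: projective_tensr d (rbraid C) _ _ pP.
rewrite -gE (mtr_cyclic mt) //.
(* The pivot and its inverse are inserted to reach the form of the right partial trace property. *)
rewrite -[g ∘ y']mcomp1m -tensm_id -(pivotVK Z) sl_comp -mcompA -(mtr_right mt) //.
rewrite mcompA; have [x ->] := right_ptrace_factor y ((P ◁ pivot Z) ∘ g).
by rewrite -pairingE y0 zero_lfunE.
Qed.

(** With Q the dual of P, injectivity at P and Q and the two duality embeddings close the circle dim
    Hom(P, 1) <= dim Hom(1, P) <= dim Hom(Q, 1) <= dim Hom(1, Q) <= dim Hom(P, 1). *)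
Lemma pairing_bij P : projective P -> bijective (pairing P).
Proof.
move=> pP; apply: inj_dim_bij; first exact: pairing_inj.
have pP' : projective (P^* ⊗ (I ⊗ I)).
  apply: (projective_tensr d (rbraid C)); exact: (projective_ldual (rbraid C)).
have le1 := dim_inj (pairing_inj pP); have le3 := dim_inj (pairing_inj pP').
rewrite !dim_dual in le1 le3 *; apply/eqP; rewrite eqn_leq le1 /=.
apply: leq_trans (dim_points P) _; apply: leq_trans le3 _.
apply: leq_trans (dim_copoints P (I ⊗ I)) _.
by rewrite (tens1o m I) (tenso1 m P).
Qed.

Lemma unimodular_of_trace : unimodular C.
Proof.
have [i [nat_i bij_i]] := extend_nak_family pres pairing_nat pairing_bij.
(* The extended family takes values in maps to the unit, so the unit itself is the Nakayama
   value. *)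
exists I; split; last by exists (idmor I), (idmor I); split; rewrite mcomp1m.
apply/is_nakayamaP; first exact: finite_copowers (rfinite C).
exists i; split=> //; exact: (proj_bij_universal pres).
Qed.

End PairingOfTrace.
End Unimodularity.

Theorem theorem1p4 (k : closedFieldType) (C : ribbon_ftc k) :
  (exists t : forall P : C, {scalar (mor P P)},
     modified_trace t /\ nonzero_on_proj t)
  <-> unimodular C.
Proof.
split; last exact: trace_of_unimodular.
by case=> t [mt nzt]; exact: unimodular_of_trace mt nzt.
Qed.
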